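(* Let $a_n^{(\omega)},b_n^{(\omega)}$ be ergodic Jacobi parameters with density of states $\nu$ and Lyapunov exponent $\gamma$. Let $E_0\in\mathbb{R}$ be such that (i) $\gamma(E_0)=0$; (ii) the symmetric derivative of $\nu$ exists at $E_0$ and is finite and nonzero. Then there exists $C>0$ so that with probability $1$ (i.e. for a.e. $\omega$), $$\liminf_{n\to\infty}\ n\bigl[z_n^{(1)}(E_0)-z_n^{(-1)}(E_0)\bigr]>C .$$
   Context: Ergodic Jacobi parameters: $(\Omega,\rho)$ is a probability space, $T:\Omega\to\Omega$ an ergodic (measure preserving) transformation, $f:\Omega\to(0,\infty)$ and $g:\Omega\to\mathbb{R}$ bounded measurable functions, and $a_n^{(\omega)}=f(T^n\omega)$, $b_n^{(\omega)}=g(T^n\omega)$. For fixed $\omega$, the orthonormal polynomials are defined by $p_{-1}=0$, $p_0=1$, $xp_n=a_{n+1}p_{n+1}+b_{n+1}p_n+a_np_{n-1}$, $n\ge0$. Let $\nu_{n,\omega}$ be the probability measure giving weight $1/n$ to each of the $n$ (real, simple) zeros of $p_n$; it is known that for a.e. $\omega$ it converges weakly to a measure $\nu$ independent of $\omega$ a.e., called the density of states. The symmetric derivative of $\nu$ at $E_0$ is $\lim_{h\downarrow0}\nu((E_0-h,E_0+h))/(2h)$. Transfer matrix: with $a_0\equiv1$, $T(n,E)$ is the $2\times2$ matrix with $\binom{u_{n+1}}{u_n}=T(n,E)\binom{u_1}{u_0}$ for every solution of $a_nu_{n+1}+(b_n-E)u_n+a_{n-1}u_{n-1}=0$, $n\ge1$.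 The Lyapunov exponent is $\gamma(E)=\lim_{n\to\infty}\frac1n\log\|T(n,E)\|$ (a.e. $\omega$). $z_n^{(-1)}(E_0)$ is the largest zero of $p_n$ that is $\le E_0$, and $z_n^{(1)}(E_0)$ is the smallest zero of $p_n$ that is $>E_0$ (both depend on $\omega$; the difference is read as $+\infty$ if one of them does not exist). *)

(* Defs.v *)
From mathcomp Require Import all_boot all_order all_algebra.
From mathcomp Require Import polyrcf ring.
From mathcomp Require Import all_classical all_reals all_analysis.

Set Implicit Arguments.
Unset Strict Implicit.
Unset Printing Implicit Defensive.

Import Order.TTheory GRing.Theory Num.Theory.
Import numFieldNormedType.Exports.

Local Open Scope classical_set_scope.
Local Open Scope ring_scope.

Definition measure_preserving (d : measure_display) (Omega : measurableType d)
    (R : realType) (P : probability Omega R) (T : Omega -> Omega) : Prop :=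
  measurable_fun [set: Omega] T /\
  forall A : set Omega, measurable A -> P (T @^-1` A) = P A.

(* T need not be invertible. *)
Definition ergodic (d : measure_display) (Omega : measurableType d)
    (R : realType) (P : probability Omega R) (T : Omega -> Omega) : Prop :=
  measure_preserving P T /\
  forall A : set Omega, measurable A -> T @^-1` A = A ->
    P A = 0%E \/ P A = 1%E.

Definition orbit_seq (Omega : Type) (R : realType) (T : Omega -> Omega)
    (F : Omega -> R) (w : Omega) (n : nat) : R := F (iter n T w).

Definition weak_cvg (R : realType)
    (mu : nat -> {measure set (measurableTypeR R) -> \bar R})
    (nu : {measure set (measurableTypeR R) -> \bar R}) : Prop :=
  forall phi : R -> R, continuous phi -> bounded_fun phi ->
    (\int[mu n]_x (phi x)%:E)%E @[n --> \oo] --> (\int[nu]_x (phi x)%:E)%E.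

Definition has_symmetric_derivative (R : realType)
    (nu : {measure set (measurableTypeR R) -> \bar R}) (E0 D : R) : Prop :=
  (nu `](E0 - h)%R, (E0 + h)%R[%classic * ((2 * h)^-1)%:E)%E @[h --> (0 : R)^'+] --> D%:E.

(* The pair (p_n, p_{n-1}); the value of a at 0 is irrelevant as p_{-1} = 0. *)
Fixpoint orthopoly_pair (R : realType) (a b : nat -> R) (n : nat) :
    {poly R} * {poly R} :=
  if n is m.+1 then
    let: (p, q) := orthopoly_pair a b m in
    ((a m.+1)^-1 *: ('X * p - (b m.+1) *: p - a m *: q), p)
  else (1, 0).

Definition orthopoly (R : realType) (a b : nat -> R) (n : nat) : {poly R} :=
  (orthopoly_pair a b n).1.

Lemma orthopoly_rec0 (R : realType) (a b : nat -> R) : a 1%N != 0 ->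
  'X * orthopoly a b 0 = a 1%N *: orthopoly a b 1 + b 1%N *: orthopoly a b 0.
Proof.
by move=> a1; rewrite /orthopoly /= scalerA divff// scale1r scaler0 subr0 subrK.
Qed.

Lemma orthopoly_rec (R : realType) (a b : nat -> R) (n : nat) : a n.+2 != 0 ->
  'X * orthopoly a b n.+1 =
    a n.+2 *: orthopoly a b n.+2 + b n.+2 *: orthopoly a b n.+1
    + a n.+1 *: orthopoly a b n.
Proof.
move=> an; rewrite /orthopoly /=; case: (orthopoly_pair a b n) => p q /=.
rewrite [a n.+2 *: (_ *: _)]scalerA divff// scale1r.
by rewrite [RHS]addrAC subrK subrK.
Qed.

(* For p <> 0, rootsR p is the strictly increasing list of the real roots of p.
   The n zeros of p_n are real and simple, so each gets the weight 1/n. *)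
Definition zero_counting (R : realType) (a b : nat -> R) (n : nat) :
    {measure set (measurableTypeR R) -> \bar R} :=
  let s := rootsR (orthopoly a b n) in
  mscale ((n%:R : R)^-1)%:nng
    (msum (fun i => \d_(s`_i : measurableTypeR R)) (size s)).

Definition is_density_of_states (d : measure_display) (Omega : measurableType d)
    (R : realType) (P : probability Omega R) (T : Omega -> Omega)
    (f g : Omega -> R) (nu : probability (measurableTypeR R) R) : Prop :=
  {ae P, forall w,
    weak_cvg (zero_counting (orbit_seq T f w) (orbit_seq T g w)) nu}.

(* The largest zero of p that is <= E0, with value -oo if there is none. *)
Definition zero_below (R : realType) (p : {poly R}) (E0 : R) : \bar R :=
  \big[maxe/-oo%E]_(x <- rootsR p | x <= E0) x%:E.

(* The smallest zero of p that is > E0, with value +oo if there is none. *)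
Definition zero_above (R : realType) (p : {poly R}) (E0 : R) : \bar R :=
  \big[mine/+oo%E]_(x <- rootsR p | E0 < x) x%:E.

(* This is +oo as soon as one of the two zeros does not exist. *)
Definition zero_gap (R : realType) (a b : nat -> R) (E0 : R) (n : nat) : \bar R :=
  (zero_above (orthopoly a b n) E0 - zero_below (orthopoly a b n) E0)%E.

Definition set_a0 (R : realType) (a : nat -> R) (n : nat) : R :=
  if n is 0%N then 1 else a n.

Definition transfer_step (R : realType) (a b : nat -> R) (E : R) (n : nat) :
    'M[R]_2 :=
  \matrix_(i < 2, j < 2)
    if i == 0 then (if j == 0 then (E - b n) / a n else - a n.-1 / a n)
    else (if j == 0 then 1 else 0).

Fixpoint transfer (R : realType) (a b : nat -> R) (E : R) (n : nat) : 'M[R]_2 :=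
  if n is m.+1 then transfer_step a b E m.+1 *m transfer a b E m else 1%:M.

Definition col2 (R : realType) (x y : R) : 'cV[R]_2 :=
  \col_(i < 2) if i == 0 then x else y.

Lemma transferP (R : realType) (a b : nat -> R) (E : R) (u : nat -> R) :
  (forall n, (0 < n)%N -> a n != 0) ->
  (forall n, (0 < n)%N ->
    a n * u n.+1 + (b n - E) * u n + a n.-1 * u n.-1 = 0) ->
  forall n, col2 (u n.+1) (u n) = transfer a b E n *m col2 (u 1%N) (u 0%N).
Proof.
move=> a0 hu; elim=> [|n IH] /=; first by rewrite mul1mx.
rewrite -mulmxA -IH; apply/matrixP => i j; rewrite !mxE !big_ord_recl big_ord0.
rewrite !mxE /= addr0; case: ifP => _; last by rewrite mul1r mul0r addr0.
have /= h := hu n.+1 isT; apply: (mulfI (a0 n.+1 isT)).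
have -> : a n.+1 * u n.+2 = (E - b n.+1) * u n.+1 - a n * u n.
  by apply/eqP; rewrite -subr_eq0 -[X in _ == X]h; apply/eqP; ring.
have an : a n.+1 != 0 by exact: a0.
by field.
Qed.

Definition euclidean_norm (R : realType) (m : nat) (v : 'cV[R]_m) : R :=
  Num.sqrt (\sum_i v i 0 ^+ 2).

Definition operator_norm (R : realType) (m n : nat) (M : 'M[R]_(m, n)) : R :=
  sup [set euclidean_norm (M *m v) | v in [set v | euclidean_norm v <= 1]].

Definition is_lyapunov_exponent (d : measure_display) (Omega : measurableType d)
    (R : realType) (P : probability Omega R) (T : Omega -> Omega)
    (f g : Omega -> R) (E gamma : R) : Prop :=
  {ae P, forall w,
    n%:R^-1 * ln (operator_norm
      (transfer (set_a0 (orbit_seq T f w)) (orbit_seq T g w) E n))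
    @[n --> \oo] --> gamma}.

(* Main.v *)
Require Import Defs.
From mathcomp Require Import all_boot all_order all_algebra.
From mathcomp Require Import polyrcf complex ring lra.
From mathcomp Require Import all_classical all_reals all_analysis.
From mathcomp Require Import measurable_realfun.

Set Implicit Arguments.
Unset Strict Implicit.
Unset Printing Implicit Defensive.

Import Order.TTheory GRing.Theory Num.Theory.
Import numFieldNormedType.Exports.

Local Open Scope classical_set_scope.
Local Open Scope ring_scope.

(** Write p_n and q_n for the two fundamental solutions at E0, T for the dynamics,
    k(i,j) = p_i q_j - p_j q_i, and G_n for the sum of k(i,j)^2 over i < j < n,
    which is the Gram determinant of the vectors (p_i) and (q_i), i < n.

    Spacing. Variation of constants reads p(x) = p(E0) + (x - E0) L p(x) for the
    vectors p(x) = (p_i(x)), i < n, where L is triangular with entries k(i,j) and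
    Hilbert-Schmidt norm sqrt G_n. If x <= E0 < y are zeros of p_n, the vectors
    p(x) and p(y) are orthogonal, hence far apart, and this forces
    sqrt G_n * (y - x) >= 1 ([zero_distance]). It remains to prove that almost
    surely sqrt G_n <= C n for all large n.

    Reduction to means. The kernel k(i,j) only depends on the coefficients between
    i and j, so Minkowski's determinant inequality makes sqrt G_n superadditive
    along orbits ([sqrt_gram_superadd]). For a nonnegative superadditive process
    over an ergodic map, a linear bound on the truncated means yields an almost
    sure linear bound, by a tiling argument ([superadditive_growth]). So the goal
    is E min (sqrt G_n, W) <= C n with C independent of n and W.

    Complex energies. Over a window of length N much larger than n, run the
    continued fraction M_j = z - b_{j+1} - a_{j+1}^2 / M_{j+1} at z = E0 + i eps.
    Each M_j gives a quadratic form of determinant one on the solutions at the real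
    energy E0, and from one site to the next this form grows at most by exp Y_j
    where Y_j = ln Im M_j - ln (Im M_j - eps) >= eps / Im M_j. Hence on a block of
    the window sqrt G_n is at most exp S * S / eps, S being the sum of the Y_j over
    the block. The sum of the Y_j over the window telescopes to ln |p_N(z)|^2 up to
    a constant ([sum_blocks_le]). So it suffices that the mean of ln |p_N(z)|^2,
    outside a set of small probability, is at most C eps N.

    Thouless-type bound. Let delta = exp (- 3 kappa N). As the Lyapunov exponent
    vanishes, |p_N(E0 + i delta)| <= exp (2 kappa N) with probability close to one
    ([psol_perturb]). The difference ln |p_N(E0 + i eps)|^2 - ln |p_N(E0 + i delta)|^2
    is a sum over the zeros of p_N ([potential_diff_roots]) and is superadditive up
    to a cost of order ln (1 / delta), that is of order kappa N. Its mean is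
    therefore at most N times the integral against nu of the corresponding
    logarithmic ratio, plus this cost ([mean_potential_diff_le]), and the integral
    is of order eps since the symmetric derivative is finite ([log_ratio_bound]).
    Letting N tend to infinity, then kappa and eps to zero, gives the bound on the
    means ([mean_min_sqrt_gram_bound]). *)

(** * Solutions of the Jacobi recursion *)

(** Along an orbit, moving the origin of the coefficients by n is the same as
    applying the n-th iterate of the dynamics to the base point; every
    statement about a window far from the origin is transported this way. *)
Definition shift_seq (X : Type) (n : nat) (a : nat -> X) (k : nat) : X := a (n + k)%N.

(** The pair is (u_n, a_n u_{n-1}). Carrying a_n u_{n-1} instead of u_{n-1}
    makes the step have determinant one; the initial value c stands for the
    product a_0 u_{-1}. *)
Fixpoint jacobi_sol (F : fieldType) (a b : nat -> F) (z u c : F) (n : nat) : F * F :=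
  if n is m.+1 then
    (((z - b m.+1) * (jacobi_sol a b z u c m).1 - (jacobi_sol a b z u c m).2) / a m.+1,
     a m.+1 * (jacobi_sol a b z u c m).1)
  else (u, c).

(** This is p_n(z), over an arbitrary field because both real and complex
    energies occur. *)
Definition psol (F : fieldType) (a b : nat -> F) (z : F) (n : nat) : F :=
  (jacobi_sol a b z 1 0 n).1.

(** The second solution, the polynomials of the second kind: q_0 = 0 and
    q_1 = 1 / a_1. *)
Definition qsol (F : fieldType) (a b : nat -> F) (z : F) (n : nat) : F :=
  (jacobi_sol a b z 0 (-1) n).1.

Lemma jacobi_sol_linear (F : fieldType) (a b : nat -> F) (z u c : F) n :
  jacobi_sol a b z u c n =
  (u * (jacobi_sol a b z 1 0 n).1 - c * (jacobi_sol a b z 0 (-1) n).1,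
   u * (jacobi_sol a b z 1 0 n).2 - c * (jacobi_sol a b z 0 (-1) n).2).
Proof.
elim: n => [|n IH] /=; first by congr pair; ring.
by rewrite IH /=; congr pair; ring.
Qed.

Lemma jacobi_sol_shift (F : fieldType) (a b : nat -> F) (z u c : F) n m :
  jacobi_sol a b z u c (n + m) =
  jacobi_sol (shift_seq n a) (shift_seq n b) z (jacobi_sol a b z u c n).1 (jacobi_sol a b z u c n).2 m.
Proof.
elim: m => [|m IH]; first by rewrite addn0 /=; case: jacobi_sol.
by rewrite addnS /= IH /shift_seq addnS.
Qed.

(** One step of the recursion changes the Wronskian of solutions at the
    energies z and w by z - w times the product of their values at that site;
    the identity is the telescoped sum. *)
Lemma christoffel_darboux (F : fieldType) (a b : nat -> F) (z w u c u' c' : F) n :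
  (forall k, a k != 0) ->
  (jacobi_sol a b z u c n).1 * (jacobi_sol a b w u' c' n).2 -
  (jacobi_sol a b z u c n).2 * (jacobi_sol a b w u' c' n).1 =
  u * c' - c * u' +
  (z - w) * \sum_(i < n) (jacobi_sol a b z u c i).1 * (jacobi_sol a b w u' c' i).1.
Proof.
move=> a0; elim: n => [|n IH]; first by rewrite big_ord0 /=; ring.
rewrite big_ord_recr mulrDr addrA -IH /=.
by have an := a0 n.+1; field.
Qed.

Lemma wronskian (F : fieldType) (a b : nat -> F) (z : F) n :
  (forall k, a k != 0) ->
  (jacobi_sol a b z 1 0 n).1 * (jacobi_sol a b z 0 (-1) n).2 -
  (jacobi_sol a b z 1 0 n).2 * (jacobi_sol a b z 0 (-1) n).1 = -1.
Proof. by move=> a0; rewrite christoffel_darboux//; ring. Qed.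

(** As a function of j this is the solution at energy z that vanishes at i,
    normalized by a_{i+1} k(i, i+1) = 1: the discrete Green kernel of the
    recursion. *)
Definition wkernel (F : fieldType) (a b : nat -> F) (z : F) (i j : nat) : F :=
  psol a b z i * qsol a b z j - psol a b z j * qsol a b z i.

Lemma wkernel_sol (F : fieldType) (a b : nat -> F) (z u c u' c' : F) i j :
  (jacobi_sol a b z u c i).1 * (jacobi_sol a b z u' c' j).1 -
  (jacobi_sol a b z u c j).1 * (jacobi_sol a b z u' c' i).1 =
  (c * u' - u * c') * wkernel a b z i j.
Proof.
rewrite (jacobi_sol_linear a b z u c i) (jacobi_sol_linear a b z u c j) (jacobi_sol_linear a b z u' c' i).
rewrite (jacobi_sol_linear a b z u' c' j) /wkernel /psol /qsol /=; ring.
Qed.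

(** The kernel between two sites only depends on the coefficients between them,
    because p and q have the same Wronskian at every origin. This makes the Gram
    determinant below a function of the window and not of the origin. *)
Lemma wkernel_shift (F : fieldType) (a b : nat -> F) (z : F) n i j :
  (forall k, a k != 0) ->
  wkernel a b z (n + i) (n + j) = wkernel (shift_seq n a) (shift_seq n b) z i j.
Proof.
move=> a0; rewrite {1}/wkernel /psol /qsol !jacobi_sol_shift wkernel_sol.
by rewrite -opprB wronskian// opprK mul1r.
Qed.

(** Both components of the pair are propagated together; the diagonal term that
    appears at the new site is the Wronskian of p and q. *)
Lemma variation_of_constants (F : fieldType) (a b : nat -> F) (z w : F) n :
  (forall k, a k != 0) ->
  psol a b w n = psol a b z n + (w - z) * \sum_(i < n) wkernel a b z i n * psol a b w i.
Proof.
move=> a0; rewrite /wkernel /psol /qsol.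
suff [] : (jacobi_sol a b w 1 0 n).1 = (jacobi_sol a b z 1 0 n).1 + (w - z) * \sum_(i < n)
      ((jacobi_sol a b z 1 0 i).1 * (jacobi_sol a b z 0 (-1) n).1 -
       (jacobi_sol a b z 1 0 n).1 * (jacobi_sol a b z 0 (-1) i).1) * (jacobi_sol a b w 1 0 i).1 /\
  (jacobi_sol a b w 1 0 n).2 = (jacobi_sol a b z 1 0 n).2 + (w - z) * \sum_(i < n)
      ((jacobi_sol a b z 1 0 i).1 * (jacobi_sol a b z 0 (-1) n).2 -
       (jacobi_sol a b z 1 0 n).2 * (jacobi_sol a b z 0 (-1) i).1) * (jacobi_sol a b w 1 0 i).1 by [].
elim: n => [|n [IH1 IH2]]; first by rewrite !big_ord0 /= mulr0 !addr0.
have an := a0 n.+1; have W := wronskian b z n a0.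
set s1 := \sum_(i < n) _ in IH1; set s2 := \sum_(i < n) _ in IH2.
split; rewrite big_ord_recr /=.
- have -> : \sum_(i < n) ((jacobi_sol a b z 1 0 i).1 *
      (((z - b n.+1) * (jacobi_sol a b z 0 (-1) n).1 - (jacobi_sol a b z 0 (-1) n).2) / a n.+1) -
       ((z - b n.+1) * (jacobi_sol a b z 1 0 n).1 - (jacobi_sol a b z 1 0 n).2) / a n.+1 *
       (jacobi_sol a b z 0 (-1) i).1) * (jacobi_sol a b w 1 0 i).1 =
      ((z - b n.+1) * s1 - s2) / a n.+1.
    rewrite /s1 /s2 mulr_sumr -sumrB mulr_suml; apply: eq_bigr => i _; ring.
  set X := (X in _ = _ + _ * (_ + X)).
  have -> : X = (jacobi_sol a b w 1 0 n).1 / a n.+1.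
    rewrite /X; set e1 := (jacobi_sol a b z 1 0 n).1 in W *; set e2 := (jacobi_sol a b z 1 0 n).2 in W *.
    set e3 := (jacobi_sol a b z 0 (-1) n).1 in W *; set e4 := (jacobi_sol a b z 0 (-1) n).2 in W *.
    transitivity (- (e1 * e4 - e2 * e3) * (jacobi_sol a b w 1 0 n).1 / a n.+1); last by rewrite W; ring.
    by field.
  by rewrite [in LHS]IH2 [in RHS]IH1 {1}IH1; field.
- have -> : \sum_(i < n) ((jacobi_sol a b z 1 0 i).1 * (a n.+1 * (jacobi_sol a b z 0 (-1) n).1) -
       a n.+1 * (jacobi_sol a b z 1 0 n).1 *
       (jacobi_sol a b z 0 (-1) i).1) * (jacobi_sol a b w 1 0 i).1 = a n.+1 * s1.
    rewrite /s1 mulr_sumr; apply: eq_bigr => i _; ring.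
  by rewrite IH1; ring.
Qed.

(** The ring morphism is the identity for real energies and the embedding of the
    reals for complex ones. *)
Lemma horner_orthopoly (R : realType) (F : fieldType) (h : {rmorphism R -> F})
    (a b : nat -> R) (z : F) n :
  (map_poly h (orthopoly a b n)).[z] = psol (h \o a) (h \o b) z n.
Proof.
rewrite /orthopoly /psol.
suff [] : (map_poly h (orthopoly_pair a b n).1).[z] = (jacobi_sol (h \o a) (h \o b) z 1 0 n).1 /\
   h (a n) * (map_poly h (orthopoly_pair a b n).2).[z] = (jacobi_sol (h \o a) (h \o b) z 1 0 n).2 by [].
elim: n => [|n [IH1 IH2]] /=; first by rewrite rmorph1 rmorph0 hornerC horner0 mulr0.
case: orthopoly_pair IH1 IH2 => p q /= IH1 IH2; split; last by rewrite IH1.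
rewrite map_polyZ /= !rmorphB /= rmorphM /= map_polyX !map_polyZ /= !hornerE.
by rewrite fmorphV IH1 IH2; ring.
Qed.

(** * The Gram determinant of the fundamental solutions *)

Definition gram_det (R : realType) (u v : nat -> R) (n : nat) : R :=
  (\sum_(i < n) u i ^+ 2) * (\sum_(i < n) v i ^+ 2) -
  (\sum_(i < n) u i * v i) ^+ 2.

Lemma lagrange_identity (R : realType) (u v : nat -> R) n :
  gram_det u v n = \sum_(j < n) \sum_(i < j) (u i * v j - u j * v i) ^+ 2.
Proof.
rewrite /gram_det; elim: n => [|n IH]; first by rewrite !big_ord0; ring.
rewrite [RHS]big_ord_recr -IH /=.
have -> : \sum_(i < n) (u i * v n - u n * v i) ^+ 2 =
    v n ^+ 2 * \sum_(i < n) u i ^+ 2 + u n ^+ 2 * \sum_(i < n) v i ^+ 2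
    - 2 * u n * v n * \sum_(i < n) u i * v i.
  rewrite !mulr_sumr -big_split -sumrB /=; apply: eq_bigr => i _; ring.
by rewrite !big_ord_recr /=; ring.
Qed.

Lemma gram_det_ge0 (R : realType) (u v : nat -> R) n : 0 <= gram_det u v n.
Proof.
rewrite lagrange_identity; apply: sumr_ge0 => j _; apply: sumr_ge0 => i _.
exact: sqr_ge0.
Qed.

(** Minkowski's determinant inequality for positive semidefinite matrices of
    size two, with rows (a, c) and (c, b). *)
Lemma sqrt_det2_superadd (R : realType) (a1 b1 c1 a2 b2 c2 : R) :
  0 <= a1 -> 0 <= b1 -> 0 <= a2 -> 0 <= b2 ->
  0 <= a1 * b1 - c1 ^+ 2 -> 0 <= a2 * b2 - c2 ^+ 2 ->
  Num.sqrt (a1 * b1 - c1 ^+ 2) + Num.sqrt (a2 * b2 - c2 ^+ 2) <=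
  Num.sqrt ((a1 + a2) * (b1 + b2) - (c1 + c2) ^+ 2).
Proof.
move=> a10 b10 a20 b20 d10 d20.
set s1 := Num.sqrt (a1 * b1 - _); set s2 := Num.sqrt (a2 * b2 - _).
have s10 : 0 <= s1 by exact: sqrtr_ge0.
have s20 : 0 <= s2 by exact: sqrtr_ge0.
have e1 : s1 ^+ 2 = a1 * b1 - c1 ^+ 2 by rewrite sqr_sqrtr.
have e2 : s2 ^+ 2 = a2 * b2 - c2 ^+ 2 by rewrite sqr_sqrtr.
rewrite -[leLHS]ger0_norm ?addr_ge0// -sqrtr_sqr ler_wsqrtr//.
(* Cauchy-Schwarz for (c1, s1) and (c2, s2), then the AM-GM inequality. *)
have h0 : 0 <= a1 * b2 + a2 * b1 by rewrite addr_ge0// mulr_ge0.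
have h : c1 * c2 + s1 * s2 <= (a1 * b2 + a2 * b1) / 2.
  have [?|h1] := leP (c1 * c2 + s1 * s2) 0; first by lra.
  rewrite -(ler_pXn2r (n := 2))// ?nnegrE; [|lra|lra].
  have k1 : (c1 * c2 + s1 * s2) ^+ 2 <= (c1 ^+ 2 + s1 ^+ 2) * (c2 ^+ 2 + s2 ^+ 2).
    by have := sqr_ge0 (c1 * s2 - c2 * s1); nra.
  apply: (le_trans k1); rewrite e1 e2.
  by have := sqr_ge0 (a1 * b2 - a2 * b1); nra.
nra.
Qed.

(** By Lagrange's identity this is the square root of the Gram determinant of
    the vectors (p_i) and (q_i), i < n. It is also the Hilbert-Schmidt norm of
    the triangular operator in the variation of constants formula, and it is
    the quantity that controls the spacing of zeros. *)
Definition sqrt_gram (R : realType) (a b : nat -> R) (E : R) (n : nat) : R :=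
  Num.sqrt (\sum_(j < n) \sum_(i < j) wkernel a b E i j ^+ 2).

Lemma sqrt_gramE (R : realType) (a b : nat -> R) (E : R) n :
  sqrt_gram a b E n = Num.sqrt (gram_det (psol a b E) (qsol a b E) n).
Proof. by rewrite lagrange_identity. Qed.

Lemma sqrt_gram_ge0 (R : realType) (a b : nat -> R) (E : R) n : 0 <= sqrt_gram a b E n.
Proof. exact: sqrtr_ge0. Qed.

(** The Gram matrix of a long window is the sum of those of its two halves, and
    the determinant of the second one is, by invariance of the kernel, the one
    seen from its own origin. *)
Lemma sqrt_gram_superadd (R : realType) (a b : nat -> R) (E : R) (n m : nat) :
  (forall k, a k != 0) ->
  sqrt_gram a b E n + sqrt_gram (shift_seq n a) (shift_seq n b) E m <= sqrt_gram a b E (n + m)%N.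
Proof.
move=> a0; set p := psol a b E; set q := qsol a b E.
have -> : sqrt_gram (shift_seq n a) (shift_seq n b) E m =
    Num.sqrt (gram_det (fun i => p (n + i)%N) (fun i => q (n + i)%N) m).
  rewrite lagrange_identity /sqrt_gram; congr Num.sqrt.
  by do 2!apply: eq_bigr => ? _; rewrite -wkernel_shift.
rewrite !sqrt_gramE -/p -/q.
have -> : gram_det p q (n + m) =
   (\sum_(i < n) p i ^+ 2 + \sum_(i < m) p (n + i)%N ^+ 2) *
   (\sum_(i < n) q i ^+ 2 + \sum_(i < m) q (n + i)%N ^+ 2) -
   (\sum_(i < n) p i * q i + \sum_(i < m) p (n + i)%N * q (n + i)%N) ^+ 2.
  by rewrite /gram_det !big_split_ord.
apply: sqrt_det2_superadd; try by apply: sumr_ge0 => i _; exact: sqr_ge0.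
  exact: gram_det_ge0.
exact: (gram_det_ge0 (fun i => p (n + i)%N) (fun i => q (n + i)%N)).
Qed.

Lemma cauchy_schwarz_sum (R : realType) (u v : nat -> R) n :
  (\sum_(i < n) u i * v i) ^+ 2 <= (\sum_(i < n) u i ^+ 2) * (\sum_(i < n) v i ^+ 2).
Proof. by rewrite -subr_ge0; exact: gram_det_ge0. Qed.

(** With p(x) the vector (p_i(x)), i < n, and L the triangular operator of the
    variation of constants, p(x) - p(y) = L ((x - E) p(x) - (y - E) p(y)).
    At two zeros x and y of p_n the vectors p(x) and p(y) are orthogonal, so
    the square of the left-hand side is |p(x)|^2 + |p(y)|^2, while that of the
    argument of L is at most (y - x)^2 times the same sum. Hence the norm of L
    times y - x is at least one. *)
Lemma zero_distance (R : realType) (a b : nat -> R) (E x y : R) n :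
  (forall k, a k != 0) -> x <= E -> E < y ->
  psol a b x n = 0 -> psol a b y n = 0 ->
  1 <= sqrt_gram a b E n * (y - x).
Proof.
move=> a0 xE Ey px py.
pose p := psol a b x; pose q := psol a b y; pose k := wkernel a b E.
have orth : \sum_(i < n) p i * q i = 0.
  have := christoffel_darboux b x y 1 0 1 0 n a0.
  rewrite -!/(psol _ _ _ _) px py mul0r mulr0 mul0r mulr0 !subr0 add0r.
  move/esym/eqP; rewrite mulf_eq0 => /orP[|/eqP//].
  by rewrite subr_eq0 => /eqP exy; move: (le_lt_trans xE Ey); rewrite exy ltxx.
pose w i := (x - E) * p i - (y - E) * q i.
have n0 : (0 < n)%N by case: n {orth} px py => //; rewrite /psol /= => /eqP; rewrite oner_eq0.
have diff j : p j - q j = \sum_(i < j) k i j * w i.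
  rewrite /p /q (variation_of_constants b E x j a0) (variation_of_constants b E y j a0).
  rewrite opprD addrACA subrr add0r !mulr_sumr -sumrB; apply: eq_bigr => i _.
  by rewrite /w /p /q /k; ring.
pose Np := \sum_(i < n) p i ^+ 2; pose Nq := \sum_(i < n) q i ^+ 2.
have Np0 : 0 < Np.
  rewrite /Np; case: n n0 {px py orth Np Nq} => // n _; rewrite big_ord_recl /=.
  rewrite {1}/p /psol /= expr1n ltr_pwDl//; apply: sumr_ge0 => i _; exact: sqr_ge0.
have Nq0 : 0 <= Nq by apply: sumr_ge0 => i _; exact: sqr_ge0.
have lhs : \sum_(j < n) (p j - q j) ^+ 2 = Np + Nq.
  transitivity (Np + Nq - 2 * \sum_(i < n) p i * q i); last by rewrite orth; ring.
  rewrite /Np /Nq mulr_sumr -big_split -sumrB; apply: eq_bigr => i _ /=; ring.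
have rhs : \sum_(i < n) w i ^+ 2 = (x - E) ^+ 2 * Np + (y - E) ^+ 2 * Nq.
  transitivity ((x - E) ^+ 2 * Np + (y - E) ^+ 2 * Nq
    - 2 * (x - E) * (y - E) * \sum_(i < n) p i * q i); last by rewrite orth; ring.
  rewrite /Np /Nq !mulr_sumr -big_split -sumrB; apply: eq_bigr => i _ /=.
  by rewrite /w; ring.
have hs : \sum_(j < n) (p j - q j) ^+ 2 <=
    (\sum_(j < n) \sum_(i < j) k i j ^+ 2) * \sum_(i < n) w i ^+ 2.
  rewrite mulr_suml; apply: ler_sum => j _; rewrite diff.
  apply: (le_trans (cauchy_schwarz_sum (k^~ j) w j)).
  apply: ler_wpM2l; first by apply: sumr_ge0 => i _; exact: sqr_ge0.
  have := subnKC (ltnW (ltn_ord j)); move: (nat_of_ord j) => l <-.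
  rewrite big_split_ord /= lerDl.
  by apply: sumr_ge0 => i _; exact: sqr_ge0.
have D0 : 0 <= \sum_(j < n) \sum_(i < j) k i j ^+ 2.
  by apply: sumr_ge0 => j _; apply: sumr_ge0 => i _; exact: sqr_ge0.
rewrite -(ler_pXn2r (n := 2))// ?nnegrE//; last first.
  by rewrite mulr_ge0 ?sqrt_gram_ge0//; lra.
rewrite expr1n exprMn sqr_sqrtr//; move: hs; rewrite lhs rhs.
set D := \sum_(j < n) _ in D0 *; move=> hs.
have b1 : (x - E) ^+ 2 <= (y - x) ^+ 2 by nra.
have b2 : (y - E) ^+ 2 <= (y - x) ^+ 2 by nra.
have : Np + Nq <= D * (y - x) ^+ 2 * (Np + Nq).
  apply: (le_trans hs); rewrite -mulrA; apply: ler_wpM2l => //.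
  by rewrite mulrDr lerD// ler_wpM2r// ltW.
by rewrite ler_pMl// ltr_pwDl.
Qed.

(** * Continued fractions at complex energies *)

Local Notation Re := complex.Re.
Local Notation Im := complex.Im.

Definition cseq (R : realType) (a : nat -> R) (n : nat) : R[i] := real_complex R (a n).

(** The real-valued squared modulus; the norm of the complex numbers takes its
    values in the complex numbers. *)
Definition sqmod (R : realType) (z : R[i]) : R := Re z ^+ 2 + Im z ^+ 2.

Lemma sqmodM (R : realType) (z w : R[i]) : sqmod (z * w) = sqmod z * sqmod w.
Proof. by case: z w => [x y] [u v]; rewrite /sqmod /=; ring. Qed.

Lemma sqmod_ge0 (R : realType) (z : R[i]) : 0 <= sqmod z.
Proof. by rewrite addr_ge0// sqr_ge0. Qed.

Lemma sqmod_real (R : realType) (x : R) : sqmod (real_complex R x) = x ^+ 2.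
Proof. by rewrite /sqmod /= expr0n addr0. Qed.

Lemma sqmod_eq0 (R : realType) (z : R[i]) : (sqmod z == 0) = (z == 0).
Proof. by rewrite paddr_eq0 ?sqr_ge0// !sqrf_eq0 eq_complex. Qed.

Lemma sqmod_gt0 (R : realType) (z : R[i]) : (0 < sqmod z) = (z != 0).
Proof. by rewrite lt_neqAle sqmod_ge0 andbT eq_sym sqmod_eq0. Qed.

Lemma sqmodV (R : realType) (z : R[i]) : sqmod z^-1 = (sqmod z)^-1.
Proof.
have [->|z0] := eqVneq z 0; first by rewrite invr0 /sqmod /= expr0n addr0 invr0.
apply: (mulfI (_ : sqmod z != 0)); first by rewrite sqmod_eq0.
rewrite -sqmodM divff// divff ?sqmod_eq0//.
by rewrite (_ : 1 = real_complex R 1)// sqmod_real expr1n.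
Qed.

Lemma sqmodD_le (R : realType) (z w : R[i]) : sqmod (z + w) <= 2 * sqmod z + 2 * sqmod w.
Proof.
case: z w => [x y] [u v]; rewrite /sqmod /=.
have := sqr_ge0 (x - u); have := sqr_ge0 (y - v); nra.
Qed.

Lemma Im_inv (R : realType) (z : R[i]) : Im z^-1 = - Im z / sqmod z.
Proof. by case: z => x y; rewrite /sqmod /= mulNr. Qed.

Lemma Re_inv (R : realType) (z : R[i]) : Re z^-1 = Re z / sqmod z.
Proof. by case: z => x y; rewrite /sqmod. Qed.

Lemma Im_gt0_neq0 (R : realType) (z : R[i]) : 0 < Im z -> z != 0.
Proof. by apply: contraTneq => ->; rewrite ltxx. Qed.

(** Minus the inverse of the Weyl m-function of a finite window: the value of
    a_0 u_{-1} / u_0 for the solution with u_{L+1} = 0. It lies in the upper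
    half-plane when z does. *)
Fixpoint cfrac (R : realType) (L : nat) (a b : nat -> R) (z : R[i]) : R[i] :=
  if L is L'.+1 then
    z - cseq b 1 - cseq a 1 ^+ 2 / cfrac L' (shift_seq 1 a) (shift_seq 1 b) z
  else z - cseq b 1.

Lemma Im_cfracS (R : realType) L (a b : nat -> R) (z : R[i]) :
  let M := cfrac L (shift_seq 1 a) (shift_seq 1 b) z in
  Im (cfrac L.+1 a b z) = Im z + a 1%N ^+ 2 * Im M / sqmod M.
Proof.
move=> M; rewrite [cfrac _ _ _ _]/= -/M.
rewrite -[_ * Im M / _]mulrA (_ : Im M / sqmod M = - Im M^-1); last by rewrite Im_inv mulNr opprK.
by move: (M^-1) => {M} [u v]; case: z => x y; rewrite /cseq /=; ring.
Qed.

Lemma Re_cfracS (R : realType) L (a b : nat -> R) (z : R[i]) :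
  let M := cfrac L (shift_seq 1 a) (shift_seq 1 b) z in
  Re (cfrac L.+1 a b z) = Re z - b 1%N - a 1%N ^+ 2 * Re M / sqmod M.
Proof.
move=> M; rewrite [cfrac _ _ _ _]/= -/M -[_ * Re M / _]mulrA -Re_inv.
by move: (M^-1) => {M} [u v]; case: z => x y; rewrite /cseq /=; ring.
Qed.

Lemma Im_cfrac_ge (R : realType) L (a b : nat -> R) (z : R[i]) :
  0 < Im z -> Im z <= Im (cfrac L a b z).
Proof.
move=> z0; elim: L a b => [|L IH] a b.
  by case: z {z0} => x y; rewrite /cseq /= subr0.
rewrite Im_cfracS lerDl divr_ge0 ?sqmod_ge0// mulr_ge0 ?sqr_ge0//.
exact: le_trans (ltW z0) (IH _ _).
Qed.

Lemma Im_cfrac_gt0 (R : realType) L (a b : nat -> R) (z : R[i]) :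
  0 < Im z -> 0 < Im (cfrac L a b z).
Proof. by move=> z0; exact: lt_le_trans (Im_cfrac_ge _ _ _ z0). Qed.

Lemma cfrac_neq0 (R : realType) L (a b : nat -> R) (z : R[i]) :
  0 < Im z -> cfrac L a b z != 0.
Proof. by move=> z0; exact/Im_gt0_neq0/Im_cfrac_gt0. Qed.

Lemma sqmod_cfrac_ge (R : realType) L (a b : nat -> R) (z : R[i]) :
  0 < Im z -> Im z ^+ 2 <= sqmod (cfrac L a b z).
Proof.
move=> z0; rewrite /sqmod; have := Im_cfrac_ge L a b z0.
have := sqr_ge0 (Re (cfrac L a b z)); nra.
Qed.

Lemma sqmod_cfrac_le (R : realType) L (a b : nat -> R) (z : R[i]) (A : R) :
  0 < Im z -> (forall k, 0 < a k <= A) -> (forall k, `|b k| <= A) ->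
  sqmod (cfrac L a b z) <= 4 * sqmod z + 4 * A ^+ 2 + 2 * A ^+ 4 / Im z ^+ 2.
Proof.
move=> z0 ha hb.
have /andP[a10 a1A] := ha 1%N; have A0 : 0 < A by exact: lt_le_trans a1A.
have h1 : sqmod (z - cseq b 1) <= 2 * sqmod z + 2 * A ^+ 2.
  apply: (le_trans (sqmodD_le _ _)); rewrite lerD2l ler_wpM2l//.
  rewrite /cseq -rmorphN sqmod_real sqrrN -(real_normK (num_real _)).
  by rewrite ler_pXn2r ?nnegrE// ltW.
case: L => [|L] /=.
  apply: (le_trans h1).
  have : 0 <= A ^+ 4 / Im z ^+ 2 by rewrite divr_ge0 ?exprn_ge0// ltW.
  have := sqmod_ge0 z; have := sqr_ge0 A; lra.
apply: (le_trans (sqmodD_le _ _)).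
have : sqmod (- (cseq a 1 ^+ 2 / cfrac L (shift_seq 1 a) (shift_seq 1 b) z)) <= A ^+ 4 / Im z ^+ 2.
  rewrite -mulN1r 2!sqmodM sqmodV (_ : -1 = real_complex R (-1)); last by rewrite rmorphN.
  rewrite sqmod_real sqrrN expr1n mul1r /cseq -rmorphXn sqmod_real -exprM.
  apply: ler_pM; rewrite ?exprn_ge0 ?invr_ge0 ?sqmod_ge0//; first exact: ltW.
    by rewrite ler_pXn2r ?nnegrE// ltW.
  rewrite lef_pV2 ?posrE ?exprn_gt0 ?sqmod_gt0 ?cfrac_neq0//; exact: sqmod_cfrac_ge.
lra.
Qed.

(** One step of the continued fraction is a real Moebius map, an isometry of the
    hyperbolic plane, followed by the vertical translation by Im z. The cost is
    the hyperbolic length of this translation. *)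
Definition cost (R : realType) (z M : R[i]) : R := ln (Im M) - ln (Im M - Im z).

Definition costs (R : realType) (a b : nat -> R) (z : R[i]) (L j : nat) : R :=
  cost z (cfrac (L - j) (shift_seq j a) (shift_seq j b) z).

Lemma costs_shift (R : realType) (a b : nat -> R) (z : R[i]) (L m j : nat) :
  costs (shift_seq m a) (shift_seq m b) z (L - m) j = costs a b z L (m + j).
Proof.
rewrite /costs subnDA; congr (cost z (cfrac _ _ _ z)); apply: funext => k;
by rewrite /shift_seq addnA.
Qed.

(** Im M_j - Im z equals a_{j+1}^2 Im M_{j+1} / |M_{j+1}|^2, so each cost is a
    difference of logarithms of Im M_j plus ln (|M_{j+1}|^2 / a_{j+1}^2); the
    product of the M_{j+1} / a_{j+1} is the ratio of the values of
    u M - c at the two ends. At the right end this value is a_{L+1} u_{L+1}. *)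
Lemma cost_telescope (R : realType) L (a b : nat -> R) (z u c : R[i]) :
  0 < Im z -> (forall k, 0 < a k) ->
  u * cfrac L a b z - c != 0 ->
  \sum_(j < L) costs a b z L j =
  ln (Im (cfrac L a b z)) - ln (Im z)
  + ln (sqmod (cseq a L.+1 * (jacobi_sol (cseq a) (cseq b) z u c L.+1).1))
  - ln (sqmod (u * cfrac L a b z - c)).
Proof.
move=> z0; elim: L a b u c => [|L IH] a b u c ha h0.
  rewrite big_ord0 /=.
  have a1 : cseq a 1 != 0 by rewrite /cseq fmorph_eq0 gt_eqF.
  have -> : Im (z - cseq b 1) = Im z by case: z {z0 h0} => x y; rewrite /cseq /= subr0.
  rewrite mulrCA mulfV// mulr1 [u * _]mulrC; ring.
rewrite big_ord_recl.
have -> : \sum_(i < L) costs a b z L.+1 (lift ord0 i) =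
    \sum_(i < L) costs (shift_seq 1 a) (shift_seq 1 b) z L i.
  by apply: eq_bigr => i _; rewrite -[X in costs _ _ _ X i](subn1 L.+1) costs_shift.
have a10 := ha 1%N.
have ca1 : cseq a 1 != 0 by rewrite /cseq fmorph_eq0 gt_eqF.
set a' := shift_seq 1 a; set b' := shift_seq 1 b.
set M := cfrac L.+1 a b z in h0 *; set M' := cfrac L a' b' z.
have ME : M = z - cseq b 1 - cseq a 1 ^+ 2 / M' by [].
have M'0 : M' != 0 by exact: cfrac_neq0.
set u1 := ((z - cseq b 1) * u - c) / cseq a 1; set c1 := cseq a 1 * u.
have key : u1 * M' - c1 = M' / cseq a 1 * (u * M - c).
  by rewrite ME /u1 /c1; field; rewrite M'0 ca1.
rewrite (IH a' b' u1 c1); last 2 first.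
- by move=> k; exact: ha.
- by rewrite key !mulf_neq0// invr_neq0.
rewrite -/M'.
have -> : cseq a' L.+1 * (jacobi_sol (cseq a') (cseq b') z u1 c1 L.+1).1 =
    cseq a L.+2 * (jacobi_sol (cseq a) (cseq b) z u c L.+2).1.
  by rewrite -[L.+2]add1n jacobi_sol_shift.
rewrite key.
have y'0 : 0 < Im M' by exact: Im_cfrac_gt0.
have n'0 : 0 < sqmod M' by rewrite sqmod_gt0.
have nM0 : 0 < sqmod (u * M - c) by rewrite sqmod_gt0.
have -> : costs a b z L.+1 0 = ln (Im M) - ln (Im M - Im z) by rewrite /costs subn0.
have -> : Im M - Im z = a 1%N ^+ 2 * Im M' / sqmod M'.
  by rewrite /M Im_cfracS -/M' addrAC subrr add0r.
have na : sqmod (cseq a 1) = a 1%N ^+ 2 by rewrite sqmod_real.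
have -> : sqmod (M' / cseq a 1 * (u * M - c)) =
    sqmod M' / a 1%N ^+ 2 * sqmod (u * M - c) by rewrite 2!sqmodM sqmodV na.
have a20 : 0 < a 1%N ^+ 2 by rewrite exprn_gt0.
move: (a 1%N ^+ 2) a20 {na} => A2 a20.
rewrite !lnM ?posrE ?mulr_gt0 ?invr_gt0// !lnV ?posrE//.
ring.
Qed.

(** * From the continued fraction to the Gram determinant *)

(** The quadratic form of determinant one in (v, c) attached to the point M of
    the upper half-plane: the squared modulus of c - M v divided by Im M. *)
Definition hyp_form (R : realType) (M : R[i]) (v c : R) : R :=
  (c - Re M * v) ^+ 2 / Im M + Im M * v ^+ 2.

Lemma shift_seqD (X : Type) (m n : nat) (a : nat -> X) :
  shift_seq n (shift_seq m a) = shift_seq (m + n) a.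
Proof. by apply: funext => k; rewrite /shift_seq addnA. Qed.

(** The linear form (u, c) |-> u_{L+1} vanishes on the solution that defines M,
    for which c = M u; so it is a multiple of u M - c. *)
Lemma jacobi_sol_cfrac (R : realType) (L : nat) (a b : nat -> R) (z : R[i]) :
  0 < Im z -> (forall k, 0 < a k) ->
  exists2 t : R[i], t != 0 & forall u c,
    (jacobi_sol (cseq a) (cseq b) z u c L.+1).1 = t * (u * cfrac L a b z - c).
Proof.
move=> z0; elim: L a b => [|L IH] a b ha.
  have a1 : cseq a 1 != 0 by rewrite /cseq fmorph_eq0 gt_eqF.
  exists (cseq a 1)^-1; first by rewrite invr_neq0.
  by move=> u c /=; ring.
have a1 : cseq a 1 != 0 by rewrite /cseq fmorph_eq0 gt_eqF.
have [t t0 ht] := IH (shift_seq 1 a) (shift_seq 1 b) (fun k => ha _).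
have := cfrac_neq0 L (shift_seq 1 a) (shift_seq 1 b) z0.
set M' := cfrac _ _ _ _ in ht * => M'0.
exists (t * (M' / cseq a 1)); first by rewrite !mulf_neq0 ?invr_neq0.
move=> u c; rewrite -[L.+2]add1n jacobi_sol_shift ht /= -/M'.
by field; rewrite a1 M'0.
Qed.

(** p_{n+1} is a nonzero multiple of M, which lies in the upper half-plane. *)
Lemma psol_neq0 (R : realType) (n : nat) (a b : nat -> R) (z : R[i]) :
  0 < Im z -> (forall k, 0 < a k) -> psol (cseq a) (cseq b) z n != 0.
Proof.
move=> z0 ha; case: n => [|n]; first exact: oner_neq0.
rewrite /psol; have [t t0 ->] := jacobi_sol_cfrac n b z0 ha.
by rewrite mul1r subr0 mulf_neq0// cfrac_neq0.
Qed.

Lemma cost_expR (R : realType) (z M : R[i]) : 0 < Im M - Im z -> 0 < Im M ->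
  expR (cost z M) = Im M / (Im M - Im z).
Proof. by move=> h1 h2; rewrite /cost expRB !lnK ?posrE. Qed.

Lemma Im_cfrac_gt (R : realType) (L : nat) (a b : nat -> R) (z : R[i]) :
  0 < Im z -> 0 < a 1%N -> 0 < Im (cfrac L.+1 a b z) - Im z.
Proof.
move=> z0 a0; rewrite Im_cfracS addrAC subrr add0r divr_gt0//.
  by rewrite mulr_gt0 ?exprn_gt0// Im_cfrac_gt0.
by rewrite sqmod_gt0 cfrac_neq0.
Qed.

(** From ln r <= r - 1 with r = 1 - Im z / Im M. *)
Lemma cost_ge (R : realType) (L : nat) (a b : nat -> R) (z : R[i]) :
  0 < Im z -> 0 < a 1%N ->
  Im z / Im (cfrac L.+1 a b z) <= cost z (cfrac L.+1 a b z).
Proof.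
move=> z0 a0; have h := Im_cfrac_gt L b z0 a0; have M0 := Im_cfrac_gt0 L.+1 a b z0.
set M := cfrac L.+1 a b z in h M0 *.
rewrite -[cost z M]opprK lerNr /cost opprB -ln_div ?posrE//.
have -> : - (Im z / Im M) = (Im M - Im z) / Im M - 1 by field; rewrite gt_eqF.
have r0 : 0 < (Im M - Im z) / Im M by rewrite divr_gt0.
by have := @le_ln1Dx R ((Im M - Im z) / Im M - 1); rewrite (addrC 1) subrK; lra.
Qed.

(** A step of the recursion at the real energy E maps the form of M' to the
    form of the point z - b_1 - a_1^2 / M' lowered by eps, exactly. Raising
    that point back by eps multiplies the form by at most exp (cost). *)
Lemma hyp_form_step (R : realType) (L : nat) (a b : nat -> R) (E eps v c : R) :
  0 < eps -> 0 < a 1%N ->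
  hyp_form (cfrac L (shift_seq 1 a) (shift_seq 1 b) (Complex E eps))
    (((E - b 1%N) * v - c) / a 1%N) (a 1%N * v) <=
  expR (cost (Complex E eps) (cfrac L.+1 a b (Complex E eps))) *
  hyp_form (cfrac L.+1 a b (Complex E eps)) v c.
Proof.
set z := Complex E eps; move=> eps0 a0; have z0 : 0 < Im z by exact: eps0.
have h := Im_cfrac_gt L b z0 a0; have M0 := Im_cfrac_gt0 L.+1 a b z0.
rewrite cost_expR// /hyp_form Re_cfracS.
rewrite Im_cfracS in h M0 *.
rewrite (addrAC (Im z)) subrr add0r in h *.
have y0 := Im_cfrac_gt0 L (shift_seq 1 a) (shift_seq 1 b) z0.
have n0 : sqmod (cfrac L (shift_seq 1 a) (shift_seq 1 b) z) != 0.
  by rewrite sqmod_eq0 cfrac_neq0.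
case: (cfrac L _ _ z) h M0 y0 n0 => x' y'; rewrite /sqmod /= => h M0 y0 n0.
set n := x' ^+ 2 + y' ^+ 2 in h M0 n0 *; set A := a 1%N in a0 h M0 *.
set w := A ^+ 2 * y' / n in h M0 *; set B := b 1%N.
set X := E - B - _; set Y := eps + w.
have -> : (A * v - x' * (((E - B) * v - c) / A)) ^+ 2 / y' +
    y' * (((E - B) * v - c) / A) ^+ 2 = (c - X * v) ^+ 2 / w + w * v ^+ 2.
  have nn : n != 0 by [].
  rewrite /X /w /n; rewrite /n in nn; field.
  by rewrite nn !gt_eqF.
have -> : Y / w * ((c - X * v) ^+ 2 / Y + Y * v ^+ 2) =
    (c - X * v) ^+ 2 / w + Y ^+ 2 / w * v ^+ 2.
  by field; rewrite !gt_eqF.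
rewrite lerD2l ler_wpM2r ?sqr_ge0// ler_pdivlMr// -expr2.
by rewrite ler_pXn2r ?nnegrE ?(ltW h) ?(ltW M0)// /Y lerDr ltW.
Qed.

Lemma jacobi_sol_growth (R : realType) (n L : nat) (a b : nat -> R) (E eps v c : R) :
  0 < eps -> (forall k, 0 < a k) -> (n <= L)%N ->
  Im (cfrac (L - n) (shift_seq n a) (shift_seq n b) (Complex E eps)) *
    (jacobi_sol a b E v c n).1 ^+ 2 <=
  expR (\sum_(j < n) costs a b (Complex E eps) L j) * hyp_form (cfrac L a b (Complex E eps)) v c.
Proof.
set z := Complex E eps; move=> eps0; elim: n L a b v c => [|n IH] L a b v c ha nL.
  rewrite big_ord0 expR0 mul1r subn0 /= /hyp_form lerDr divr_ge0 ?sqr_ge0//.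
  by apply/ltW/Im_cfrac_gt0.
case: L nL => // L; rewrite ltnS => nL; rewrite subSS.
have := IH L (shift_seq 1 a) (shift_seq 1 b) (((E - b 1%N) * v - c) / a 1%N)
  (a 1%N * v) (fun k => ha _) nL.
rewrite !shift_seqD add1n -/z => h.
have -> : (jacobi_sol a b E v c n.+1).1 =
    (jacobi_sol (shift_seq 1 a) (shift_seq 1 b) E
      (((E - b 1%N) * v - c) / a 1%N) (a 1%N * v) n).1.
  by rewrite -[n.+1]add1n jacobi_sol_shift.
apply: (le_trans h); rewrite big_ord_recl expRD -mulrA mulrCA.
have -> : \sum_(i < n) costs a b z L.+1 (lift ord0 i) =
    \sum_(i < n) costs (shift_seq 1 a) (shift_seq 1 b) z L i.
  by apply: eq_bigr => i _; rewrite -[X in costs _ _ _ X i](subn1 L.+1) costs_shift.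
apply: ler_wpM2l; first exact: expR_ge0.
exact: hyp_form_step.
Qed.

Lemma costs_ge (R : realType) (L j : nat) (a b : nat -> R) (z : R[i]) :
  0 < Im z -> (forall k, 0 < a k) -> (j < L)%N ->
  Im z / Im (cfrac (L - j) (shift_seq j a) (shift_seq j b) z) <= costs a b z L j.
Proof.
move=> z0 ha jL; rewrite /costs; have : (0 < L - j)%N by rewrite subn_gt0.
by case: (L - j)%N => // m _; apply: cost_ge => //; exact: ha.
Qed.

Lemma costs_ge0 (R : realType) (L j : nat) (a b : nat -> R) (z : R[i]) :
  0 < Im z -> (forall k, 0 < a k) -> (j < L)%N -> 0 <= costs a b z L j.
Proof.
move=> z0 ha jL; apply: le_trans (costs_ge b z0 ha jL).
by rewrite divr_ge0// ltW// Im_cfrac_gt0.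
Qed.

(** Two real solutions that are orthonormal for the form of M at the origin have
    Wronskian plus or minus one, so their Gram determinant is the one of p
    and q, and it is at most the product of their square sums. Each value is
    bounded through the form, which contains the term Im M v^2, and 1 / Im M
    is at most cost / eps. *)
Lemma sqrt_gram_le (R : realType) (n L : nat) (a b : nat -> R) (E eps : R) :
  0 < eps -> (forall k, 0 < a k) -> (n <= L)%N ->
  sqrt_gram a b E n <= expR (\sum_(j < n) costs a b (Complex E eps) L j) *
    ((\sum_(j < n) costs a b (Complex E eps) L j) / eps).
Proof.
set z := Complex E eps; set S := \sum_(j < n) _; move=> eps0 ha nL.
have z0 : 0 < Im z by exact: eps0.
set M := cfrac L a b z; have y0 : 0 < Im M by exact: Im_cfrac_gt0.
(* The vectors (1 / r, Re M / r) and (0, r) form an orthonormal basis for the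
   form of M. *)
set r := Num.sqrt (Im M); have r0 : 0 < r by rewrite sqrtr_gt0.
have r2 : r ^+ 2 = Im M by rewrite sqr_sqrtr// ltW.
pose u i := (jacobi_sol a b E r^-1 (Re M / r) i).1; pose v i := (jacobi_sol a b E 0 r i).1.
have hu : hyp_form M r^-1 (Re M / r) = 1.
  by rewrite /hyp_form subrr expr0n mul0r add0r -r2 exprVn divff// expf_neq0// gt_eqF.
have hv : hyp_form M 0 r = 1.
  by rewrite /hyp_form mulr0 subr0 r2 divff ?gt_eqF// expr0n mulr0 addr0.
have bound w c i : hyp_form M w c = 1 -> (i < n)%N ->
    (jacobi_sol a b E w c i).1 ^+ 2 <= expR S * (costs a b z L i / eps).
  move=> hw iN; have iL := leq_trans iN nL.
  have := jacobi_sol_growth b E w c eps0 ha (ltnW iL); rewrite -/z -/M hw mulr1 => g.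
  have yi : 0 < Im (cfrac (L - i) (shift_seq i a) (shift_seq i b) z) by exact: Im_cfrac_gt0.
  move: g; rewrite mulrC -ler_pdivlMr// => g; apply: (le_trans g).
  apply: ler_pM; rewrite ?expR_ge0 ?invr_ge0 ?(ltW yi)//.
    rewrite ler_expR /S -(subnKC (ltnW iN)) big_split_ord /= lerDl.
    apply: sumr_ge0 => j _; apply: costs_ge0 => //; apply: leq_trans nL.
    by rewrite -ltn_subRL.
  by have := costs_ge b z0 ha iL; rewrite -/z /= ler_pdivlMr// mulrC.
have -> : sqrt_gram a b E n = Num.sqrt (gram_det u v n).
  rewrite lagrange_identity /sqrt_gram; congr Num.sqrt.
  apply: eq_bigr => j _; apply: eq_bigr => i _.
  by rewrite /u /v wkernel_sol mulr0 sub0r mulVf ?gt_eqF// mulN1r sqrrN.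
have su : \sum_(i < n) u i ^+ 2 <= expR S * (S / eps).
  rewrite {2}/S mulr_suml mulr_sumr; apply: ler_sum => i _; exact: bound.
have sv : \sum_(i < n) v i ^+ 2 <= expR S * (S / eps).
  rewrite {2}/S mulr_suml mulr_sumr; apply: ler_sum => i _; exact: bound.
have su0 : 0 <= \sum_(i < n) u i ^+ 2 by apply: sumr_ge0 => i _; exact: sqr_ge0.
have sv0 : 0 <= \sum_(i < n) v i ^+ 2 by apply: sumr_ge0 => i _; exact: sqr_ge0.
rewrite -[leRHS]ger0_norm ?(le_trans su0 su)// -sqrtr_sqr ler_wsqrtr//.
rewrite /gram_det expr2.
by apply: le_trans (ler_pM su0 sv0 su sv); rewrite gerBl sqr_ge0.
Qed.

(** Truncation removes the exponential of the costs, which has no useful mean: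
    with S the sum of the costs, min (q, W) (1 - S) <= q exp (- S) <= S / eps
    and min (q, W) S <= W S. *)
Lemma min_sqrt_gram_le (R : realType) (n L : nat) (a b : nat -> R) (E eps W : R) :
  0 < eps -> (forall k, 0 < a k) -> (n <= L)%N -> 0 <= W ->
  Num.min (sqrt_gram a b E n) W <=
  (eps^-1 + W) * \sum_(j < n) costs a b (Complex E eps) L j.
Proof.
move=> eps0 ha nL W0; have := sqrt_gram_le b E eps0 ha nL.
set S := \sum_(j < n) _; set q := sqrt_gram _ _ _ _ => hq.
have q0 : 0 <= q by exact: sqrt_gram_ge0.
have S0 : 0 <= S.
  by apply: sumr_ge0 => j _; apply: costs_ge0 => //; exact: leq_trans nL.
set m := Num.min q W; have m0 : 0 <= m by rewrite le_min q0.
have mq : m <= q by rewrite ge_min lexx.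
have mW : m <= W by rewrite ge_min lexx orbT.
have e1 : 1 - S <= expR (- S) by exact: expR_ge1Dx.
have h1 : m * expR (- S) <= S / eps.
  by rewrite expRN ler_pdivrMr ?expR_gt0// mulrC; exact: le_trans mq hq.
rewrite mulrDl [eps^-1 * S]mulrC.
have h2 : m * (1 - S) <= m * expR (- S) by rewrite ler_wpM2l.
have h3 : m * S <= W * S by rewrite ler_wpM2r.
lra.
Qed.

(** One continued fraction over the whole window serves all its blocks, and the
    sum of all the costs is given by the value of p at the complex energy. *)
Lemma sum_blocks_le (R : realType) (n B : nat) (a b : nat -> R) (E eps W A : R) :
  0 < eps -> (forall k, 0 < a k <= A) -> 0 <= W ->
  \sum_(k < B) Num.min (sqrt_gram (shift_seq (k * n) a) (shift_seq (k * n) b) E n) W <=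
  (eps^-1 + W) *
  (ln (sqmod (psol (cseq a) (cseq b) (Complex E eps) (B * n).+1)) + 2 * ln (A / eps)).
Proof.
move=> eps0 haA W0.
have ha k : 0 < a k by case/andP: (haA k).
set z := Complex E eps; set L := (B * n)%N.
have z0 : 0 < Im z by exact: eps0.
have h1 B' : (B' <= B)%N ->
    \sum_(k < B') Num.min (sqrt_gram (shift_seq (k * n) a) (shift_seq (k * n) b) E n) W <=
    (eps^-1 + W) * \sum_(j < B' * n) costs a b z L j.
  elim: B' => [|B' IH] BB; first by rewrite mul0n !big_ord0 mulr0.
  rewrite big_ord_recr mulSn addnC big_split_ord /= mulrDr lerD ?IH// 1?ltnW//.
  have nL : (n <= L - B' * n)%N.
    by rewrite leq_subRL ?leq_mul2r ?(ltnW BB) ?orbT// addnC -mulSn leq_mul2r BB orbT.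
  apply: (le_trans (min_sqrt_gram_le _ _ eps0 (fun k => ha _) nL W0)).
  rewrite ler_wpM2l ?addr_ge0 ?invr_ge0 ?(ltW eps0)// ler_sum// => i _.
  by rewrite costs_shift.
apply: (le_trans (h1 B (leqnn _))); rewrite -/L.
rewrite ler_wpM2l ?addr_ge0 ?invr_ge0 ?(ltW eps0)//.
set M := cfrac L a b z; have y0 : 0 < Im M by exact: Im_cfrac_gt0.
have nM : 0 < sqmod M by rewrite sqmod_gt0 cfrac_neq0.
have M0 : 1 * M - 0 != 0 by rewrite mul1r subr0 cfrac_neq0.
have T := cost_telescope z0 ha M0.
rewrite T mul1r subr0 -/(psol _ _ _ _) sqmodM.
have p0 : 0 < sqmod (psol (cseq a) (cseq b) z L.+1) by rewrite sqmod_gt0 psol_neq0.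
have := ha L.+1; have /andP[_] := haA L.+1; rewrite /cseq sqmod_real.
move: (a L.+1) (psol _ _ _ _) p0 => al p p0 alA al0; have A0 := lt_le_trans al0 alA.
rewrite lnM ?posrE ?exprn_gt0// lnXn// ln_div ?posrE//.
have e1 : ln (Im M) + ln eps <= ln (sqmod M).
  rewrite -lnM ?posrE// ler_ln ?posrE ?mulr_gt0// /sqmod.
  have := sqr_ge0 (Re M); have := Im_cfrac_ge L a b z0; rewrite -/M /=; nra.
have e2 : ln al <= ln A by rewrite ler_ln ?posrE.
rewrite -/M /=; lra.
Qed.

(** * Cutting a Jacobi matrix in two *)

(** The ratio r = a_n p_{n-1} / p_n satisfies r' = a^2 / (z - b - r), a map which
    sends the closed lower half-plane to itself when Im z > 0. *)
Lemma ratio_bound (R : realType) (n : nat) (a b : nat -> R) (z : R[i]) (A : R) :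
  0 < Im z -> (forall k, 0 < a k <= A) ->
  let r := (jacobi_sol (cseq a) (cseq b) z 1 0 n).2 / psol (cseq a) (cseq b) z n in
  Im r <= 0 /\ sqmod r <= A ^+ 4 / Im z ^+ 2.
Proof.
move=> z0 haA; have ha k : 0 < a k by case/andP: (haA k).
have A0 : 0 < A by case/andP: (haA 0%N) => /lt_le_trans; apply.
elim: n => [|n [IH _]].
  rewrite [X in X / _](_ : _ = 0)// mul0r /sqmod /= expr0n addr0; split=> //.
  by rewrite divr_ge0 ?exprn_ge0// ltW.
have p0 := psol_neq0 n b z0 ha; have p1 := psol_neq0 n.+1 b z0 ha.
move: p0 p1 IH; rewrite /psol /=.
set p := (jacobi_sol _ _ _ _ _ _).1; set s := (jacobi_sol _ _ _ _ _ _).2 => p0 p1 IH.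
have an : cseq a n.+1 != 0 by rewrite /cseq fmorph_eq0 gt_eqF.
set w := z - cseq b n.+1 - s / p.
have w0 : Im z <= Im w.
  rewrite /w; move: (s / p) (z) IH z0 => [u v] [x y] /= h1 h2; lra.
have wn0 : w != 0 by apply: Im_gt0_neq0; exact: lt_le_trans w0.
have -> : cseq a n.+1 * p / (((z - cseq b n.+1) * p - s) / cseq a n.+1) =
    cseq a n.+1 ^+ 2 / w.
  have -> : (z - cseq b n.+1) * p - s = p * w by rewrite /w; field.
  by field; rewrite p0 wn0 an.
have nw : Im z ^+ 2 <= sqmod w.
  by rewrite /sqmod; have := sqr_ge0 (Re w); nra.
have nw0 : 0 < sqmod w by rewrite sqmod_gt0.
have /andP[a0 aA] := haA n.+1.
rewrite sqmodM sqmodV /cseq -rmorphXn sqmod_real; split.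
  have -> : Im (real_complex R (a n.+1 ^+ 2) / w) = - (a n.+1 ^+ 2 * Im w / sqmod w).
    rewrite -mulrA -mulrN -mulNr -Im_inv.
    by case: (w^-1) => u v /=; rewrite mul0r addr0.
  by rewrite oppr_le0 divr_ge0 ?(ltW nw0)// mulr_ge0 ?sqr_ge0// (le_trans (ltW z0)).
rewrite -exprM; apply: ler_pM; rewrite ?exprn_ge0 ?invr_ge0 ?(ltW nw0)// ?(ltW a0)//.
  by rewrite ler_pXn2r ?nnegrE// ltW.
by rewrite lef_pV2 ?posrE ?exprn_gt0.
Qed.

Definition ln_sqmod_psol (R : realType) (a b : nat -> R) (E t : R) (n : nat) : R :=
  ln (sqmod (psol (cseq a) (cseq b) (Complex E t) n)).

(** Across a cut, p_{n+m} is the product of the p of the two pieces and of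
    1 - r / M, where r is the ratio at the left of the cut and M the continued
    fraction at its right. Since Im r <= 0 < Im M this factor cannot be small. *)
Lemma ln_sqmod_psol_cut (R : realType) (n m : nat) (a b : nat -> R) (E t : R) (A : R) :
  0 < t -> (forall k, 0 < a k <= A) -> (forall k, `|b k| <= A) ->
  ln_sqmod_psol a b E t n + ln_sqmod_psol (shift_seq n a) (shift_seq n b) E t m.+1
    - ln ((4 * (E ^+ 2 + t ^+ 2) + 4 * A ^+ 2 + 2 * A ^+ 4 / t ^+ 2) / t ^+ 2)
  <= ln_sqmod_psol a b E t (n + m.+1) <=
  ln_sqmod_psol a b E t n + ln_sqmod_psol (shift_seq n a) (shift_seq n b) E t m.+1
    + ln (2 + 2 * A ^+ 4 / t ^+ 4).
Proof.
move=> t0 haA hb; have ha k : 0 < a k by case/andP: (haA k).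
have A0 : 0 < A by case/andP: (haA 0%N) => /lt_le_trans; apply.
set z := Complex E t; have z0 : 0 < Im z by exact: t0.
have [k k0 hk] := jacobi_sol_cfrac m (shift_seq n b) z0 (fun j => ha (n + j)%N).
have M0 := cfrac_neq0 m (shift_seq n a) (shift_seq n b) z0.
have yM := Im_cfrac_ge m (shift_seq n a) (shift_seq n b) z0.
have nM := sqmod_cfrac_le m z0 (fun j => haA (n + j)%N) (fun j => hb (n + j)%N).
have nM' := sqmod_cfrac_ge m (shift_seq n a) (shift_seq n b) z0.
rewrite -/(shift_seq n a) -/(shift_seq n b) in hk nM.
have [r1 r2] := ratio_bound n b z0 haA.
have p0 := psol_neq0 n b z0 ha.
rewrite /ln_sqmod_psol -/z.
set M := cfrac m _ _ _ in hk M0 yM nM nM'.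
set r := _ / _ in r1 r2.
have e2 : psol (cseq (shift_seq n a)) (cseq (shift_seq n b)) z m.+1 = k * M.
  by rewrite /psol hk mul1r subr0.
have e1 : psol (cseq a) (cseq b) z (n + m.+1) =
   psol (cseq a) (cseq b) z n * (k * M) * ((M - r) / M).
  rewrite {1}/psol jacobi_sol_shift hk /r -/(psol _ _ _ n).
  by field; rewrite M0 p0.
rewrite e1 e2 [sqmod (_ * _ * _)]sqmodM [sqmod (_ * (k * M))]sqmodM.
set P := sqmod (psol _ _ _ n); have P0 : 0 < P by rewrite sqmod_gt0.
set Q := sqmod (k * M); have Q0 : 0 < Q by rewrite sqmod_gt0 mulf_neq0.
have nM0 : 0 < sqmod M by rewrite sqmod_gt0.
have MrI : t <= Im (M - r).
  by case: (M) yM => x y; case: (r) r1 => u v /=; lra.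
have nMr : t ^+ 2 <= sqmod (M - r).
  by rewrite /sqmod; have := sqr_ge0 (Re (M - r)); nra.
have nMr0 : 0 < sqmod (M - r) by apply: lt_le_trans nMr; rewrite exprn_gt0.
set K := _ + 2 * A ^+ 4 / t ^+ 2; have nMK : sqmod M <= K by exact: nM.
have K0 : 0 < K by exact: lt_le_trans nMK.
have t20 : 0 < t ^+ 2 by rewrite exprn_gt0.
rewrite sqmodM sqmodV [ln (P * Q * _)]lnM ?posrE ?mulr_gt0 ?invr_gt0//.
rewrite [ln (P * Q)]lnM ?posrE//.
rewrite !lerD2l -lnV ?posrE ?divr_gt0// invf_div !ler_ln ?posrE ?divr_gt0//; last first.
  by rewrite addr_gt0// divr_gt0 ?mulr_gt0// exprn_gt0.
apply/andP; split.
  by apply: ler_pM; rewrite ?(ltW t20) ?invr_ge0 ?(ltW K0)// lef_pV2 ?posrE.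
rewrite ler_pdivrMr//; apply: (le_trans (sqmodD_le _ _)).
rewrite -mulN1r sqmodM (_ : -1 = real_complex R (-1)); last by rewrite rmorphN.
rewrite sqmod_real sqrrN expr1n mul1r [(2 + _) * _]mulrDl lerD2l.
rewrite (_ : 2 * A ^+ 4 / t ^+ 4 * sqmod M = 2 * (A ^+ 4 * (t ^- 4 * sqmod M))); last by ring.
rewrite ler_wpM2l//; apply: (le_trans r2).
rewrite ler_wpM2l ?exprn_ge0 ?(ltW A0)//.
rewrite (_ : t ^- 2 = t ^- 4 * t ^+ 2); last by field; rewrite gt_eqF.
by rewrite ler_wpM2l// invr_ge0 exprn_ge0// ltW.
Qed.

(** The leading coefficient of p_n, the inverse of the product of the a_k,
    cancels in this difference, which is left with the contribution of the
    zeros. *)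
Definition potential_diff (R : realType) (a b : nat -> R) (E eps del : R) (n : nat) : R :=
  ln_sqmod_psol a b E eps n - ln_sqmod_psol a b E del n.

(** The cost of a cut is of the order of ln (1 / del), which will be a small
    multiple of the length of the window. *)
Lemma potential_diff_superadd (R : realType) (n m : nat) (a b : nat -> R) (E eps del A : R) :
  0 < eps -> 0 < del -> (forall k, 0 < a k <= A) -> (forall k, `|b k| <= A) ->
  (0 < m)%N ->
  potential_diff a b E eps del n + potential_diff (shift_seq n a) (shift_seq n b) E eps del m <=
  potential_diff a b E eps del (n + m)
  + ln ((4 * (E ^+ 2 + eps ^+ 2) + 4 * A ^+ 2 + 2 * A ^+ 4 / eps ^+ 2) / eps ^+ 2)
  + ln (2 + 2 * A ^+ 4 / del ^+ 4).
Proof.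
move=> e0 d0 ha hb; case: m => // m _; rewrite /potential_diff.
have /andP[h1 _] := ln_sqmod_psol_cut n m E e0 ha hb.
have /andP[_ h2] := ln_sqmod_psol_cut n m E d0 ha hb.
lra.
Qed.

Lemma size_orthopoly (R : realType) (a b : nat -> R) n :
  (forall k, 0 < a k) -> size (orthopoly a b n) = n.+1.
Proof.
move=> ha; rewrite /orthopoly.
suff [] : size (orthopoly_pair a b n).1 = n.+1 /\ (size (orthopoly_pair a b n).2 <= n)%N by [].
elim: n => [|n]; first by rewrite /= size_poly1 size_poly0.
rewrite /=; case: orthopoly_pair => p q /= [sp sq]; split; last by rewrite sp.
rewrite size_scale ?invr_neq0 ?gt_eqF//.
have p0 : p != 0 by rewrite -size_poly_eq0 sp.
have sX : size ('X * p) = n.+2 by rewrite mulrC size_mulX// sp.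
have h1 : (size (b n.+1 *: p) < n.+2)%N by rewrite (leq_ltn_trans (size_scale_leq _ _))// sp.
have h2 : (size (a n *: q) < n.+2)%N.
  by rewrite (leq_ltn_trans (size_scale_leq _ _))// ltnS ltnW.
by rewrite -addrA -opprD size_polyDl// size_polyN sX (leq_ltn_trans (size_polyD _ _))// gtn_max h1.
Qed.

Lemma jacobi_sol_rmorph (F G : fieldType) (h : {rmorphism F -> G}) (a b : nat -> F) (z u c : F) n :
  jacobi_sol (h \o a) (h \o b) (h z) (h u) (h c) n =
  (h (jacobi_sol a b z u c n).1, h (jacobi_sol a b z u c n).2).
Proof.
elim: n => //= n -> /=; congr pair; last by rewrite rmorphM.
by rewrite fmorph_div rmorphB rmorphM rmorphB.
Qed.

(** Complex conjugation commutes with the recursion, so the lower half-plane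
    reduces to the upper one. *)
Lemma psol_real_roots (R : realType) (a b : nat -> R) (z : R[i]) n :
  (forall k, 0 < a k) -> psol (cseq a) (cseq b) z n = 0 -> Im z = 0.
Proof.
move=> ha; case: (ltgtP (Im z) 0) => // [z0|z0] p0.
- have zc : 0 < Im (conjc z) by case: z {p0} z0 => x y /=; rewrite oppr_gt0.
  have := psol_neq0 n b zc ha; rewrite /psol.
  have cs (f : nat -> R) : cseq f = conjc \o cseq f.
    by apply: funext => k; rewrite /= /cseq /= oppr0.
  rewrite (cs a) (cs b) -[1](rmorph1 (@conjc R)) -[0](rmorph0 (@conjc R)).
  rewrite jacobi_sol_rmorph [(conjc _, _).1]/= -/(psol _ _ _ _) p0.
  by rewrite eqxx.
- by have := psol_neq0 n b z0 ha; rewrite p0 eqxx.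
Qed.

(** * Zeros of the orthogonal polynomials *)

(** A nonzero polynomial of size s cannot vanish at the s points 0, ..., s - 1. *)
Lemma poly_ext (R : realType) (p q : {poly R}) : (forall y, p.[y] = q.[y]) -> p = q.
Proof.
move=> pq; apply/eqP; rewrite -subr_eq0; apply/eqP/eqP; apply: contraT => d0.
have := @max_poly_roots _ (p - q) [seq i%:R | i <- iota 0 (size (p - q))] d0.
rewrite size_map size_iota ltnn => -> //.
  by apply/allP => y _; rewrite /root hornerD hornerN pq subrr.
by rewrite map_inj_uniq ?iota_uniq//; exact: (mulrIn (oner_neq0 R)).
Qed.

Lemma horner_orthopolyR (R : realType) (a b : nat -> R) (x : R) n :
  (orthopoly a b n).[x] = psol a b x n.
Proof.
by have := horner_orthopoly idfun a b x n; rewrite map_poly_id.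
Qed.

(** At a zero x of p_n, Christoffel-Darboux gives
    (X - x) sum_i p_i(x) p_i = a_n p_{n-1}(x) p_n as polynomials. If (X - x)^2
    divided p_n, the sum would vanish at x, where it is a sum of squares
    containing p_0^2 = 1. *)
Lemma orthopoly_simple (R : realType) (a b : nat -> R) (x : R) (q : {poly R}) n :
  (forall k, 0 < a k) -> orthopoly a b n = ('X - x%:P) ^+ 2 * q -> False.
Proof.
move=> ha pq; have an k : a k != 0 by rewrite gt_eqF.
have px : psol a b x n = 0.
  by rewrite -horner_orthopolyR pq hornerM horner_exp hornerXsubC subrr expr0n mul0r.
pose K := \sum_(i < n) psol a b x i *: orthopoly a b i.
have hK : ('X - x%:P) * K = (jacobi_sol a b x 1 0 n).2 *: orthopoly a b n.
  apply: poly_ext => y; rewrite hornerM hornerXsubC hornerZ horner_sum horner_orthopolyR.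
  under eq_bigr do rewrite hornerZ horner_orthopolyR.
  have := christoffel_darboux b y x 1 0 1 0 n an.
  rewrite -/(psol a b x n) px mulr0 subr0 mul0r mulr0 subrr add0r -/(psol a b y n) mulrC => ->.
  by congr (_ * _); apply: eq_bigr => i _; rewrite mulrC.
have KE : K = ('X - x%:P) * ((jacobi_sol a b x 1 0 n).2 *: q).
  apply: (mulfI (_ : 'X - x%:P != 0)); first by rewrite polyXsubC_eq0.
  by rewrite hK pq expr2 -mulrA -scalerAr -scalerAr mulrA.
have : K.[x] = 0 by rewrite KE hornerM hornerXsubC subrr mul0r.
rewrite horner_sum; under eq_bigr do rewrite hornerZ horner_orthopolyR -expr2.
case: n px {pq hK KE K} => [|n _]; first by rewrite /psol /= => /eqP; rewrite oner_eq0.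
move=> /eqP; rewrite psumr_eq0; last by move=> i _; exact: sqr_ge0.
by move=> /allP/(_ ord0 (mem_index_enum _)); rewrite /psol /= sqrf_eq0 oner_eq0.
Qed.

Lemma perm_dup (T : eqType) (s : seq T) :
  ~~ uniq s -> exists x s', perm_eq s (x :: x :: s').
Proof.
elim: s => // y t IH /=; rewrite negb_and negbK => /orP[yt|/IH[x [s' ps]]].
  by exists y, (rem y t); rewrite perm_cons perm_to_rem.
exists x, (y :: s'); rewrite -[y :: t]cat1s -[x :: x :: y :: s']/([:: x; x] ++ [:: y] ++ s').
by rewrite perm_sym perm_catCA perm_cat2l perm_sym.
Qed.

(** Over the complex numbers p_n has n zeros; they are real, and pairwise
    distinct because a repeated one would be a double zero. *)
Lemma orthopoly_split (R : realType) (a b : nat -> R) n :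
  (forall k, 0 < a k) ->
  let p := orthopoly a b n in
  p = lead_coef p *: \prod_(x <- rootsR p) ('X - x%:P) /\ size (rootsR p) = n.
Proof.
move=> ha p; have p0 : p != 0 by rewrite -size_poly_eq0 size_orthopoly.
have [r hr] := closed_field_poly_normal (map_poly (real_complex R) p).
have rI z : z \in r -> z = real_complex R (Re z).
  move=> zr; have : root (map_poly (real_complex R) p) z.
    rewrite hr rootZ ?root_prod_XsubC//.
    by rewrite lead_coef_map fmorph_eq0 lead_coef_eq0.
  rewrite /root horner_orthopoly => /eqP/(psol_real_roots ha).
  by case: z {zr} => x y /= ->.
pose s := map (@complex.Re R) r.
have ps : p = lead_coef p *: \prod_(x <- s) ('X - x%:P).
  apply: (map_poly_inj (real_complex R)); rewrite hr map_polyZ lead_coef_map rmorph_prod.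
  congr (_ *: _); rewrite big_map; apply: eq_big_seq => z zr.
  by rewrite rmorphB /= map_polyX map_polyC /= -rI.
have us : uniq s.
  apply: contraT => /perm_dup[x [s' /(perm_big _) hs]].
  exfalso; apply: (@orthopoly_simple R a b x
    (lead_coef p *: \prod_(y <- s') ('X - y%:P)) n ha).
  by rewrite -/p {1}ps hs/= !big_cons -scalerAr expr2 mulrA.
have sr : perm_eq s (rootsR p).
  apply: uniq_perm => //.
    exact: (sorted_uniq lt_trans ltxx (sorted_roots _ _ _)).
  move=> x; have /= <- := roots_on_rootsR p0 x.
  by rewrite ps rootZ ?lead_coef_eq0// root_prod_XsubC.
split; first by rewrite -(perm_big _ sr).
rewrite -(perm_size sr); have := size_orthopoly b n ha; rewrite -/p ps.
by rewrite size_scale ?lead_coef_eq0// size_prod_XsubC => -[].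
Qed.

(** This is ln (|E + i eps - x|^2 / |E + i del - x|^2), a continuous and bounded
    function of x to which weak convergence applies. *)
Definition log_ratio (R : realType) (E eps del x : R) : R :=
  ln ((x - E) ^+ 2 + eps ^+ 2) - ln ((x - E) ^+ 2 + del ^+ 2).

Lemma potential_diff_roots (R : realType) (a b : nat -> R) (E eps del : R) n :
  (forall k, 0 < a k) -> 0 < eps -> 0 < del ->
  potential_diff a b E eps del n = \sum_(x <- rootsR (orthopoly a b n)) log_ratio E eps del x.
Proof.
move=> ha e0 d0; have [ps _] := orthopoly_split b n ha.
set p := orthopoly a b n in ps *; set s := rootsR p in ps *.
have p0 : lead_coef p != 0 by rewrite lead_coef_eq0 -size_poly_eq0 size_orthopoly.
have h t : 0 < t -> ln_sqmod_psol a b E t n =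
    ln (lead_coef p ^+ 2) + \sum_(x <- s) ln ((x - E) ^+ 2 + t ^+ 2).
  move=> t0; rewrite /ln_sqmod_psol; have := horner_orthopoly (real_complex R) a b (Complex E t) n.
  rewrite -[psol (_ \o a) _ _ _]/(psol (cseq a) (cseq b) _ _) => <-; rewrite -/p {1}ps.
  rewrite map_polyZ hornerZ sqmodM sqmod_real; have l0 : 0 < lead_coef p ^+ 2.
    by rewrite lt_neqAle sqr_ge0 eq_sym sqrf_eq0 p0.
  have tp x : 0 < (x - E) ^+ 2 + t ^+ 2 by rewrite ltr_wpDl ?sqr_ge0// exprn_gt0.
  have -> : sqmod (map_poly (real_complex R) (\prod_(x <- s) ('X - x%:P))).[Complex E t] =
      \prod_(x <- s) ((x - E) ^+ 2 + t ^+ 2).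
    rewrite rmorph_prod horner_prod; elim: (s) => [|x r IH].
      by rewrite !big_nil -(rmorph1 (real_complex R)) sqmod_real expr1n.
    rewrite !big_cons sqmodM IH; congr (_ * _).
    by rewrite rmorphB /= map_polyX map_polyC hornerXsubC /sqmod /=; ring.
  rewrite lnM ?posrE//; last by apply: prodr_gt0 => x _.
  congr (_ + _); elim: (s) => [|x r IH]; first by rewrite !big_nil ln1.
  by rewrite !big_cons lnM ?posrE ?IH//; apply: prodr_gt0 => y _.
rewrite /potential_diff !h// opprD addrACA subrr add0r -sumrB.
exact: eq_bigr.
Qed.

(** * Expectations of bounded measurable functions *)

(** All the random variables whose mean is taken below are bounded, which keeps
    integrability and finiteness out of the way. *)
Definition bounded_meas (d : measure_display) (T : measurableType d) (R : realType)
    (h : T -> R) : Prop :=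
  measurable_fun [set: T] h /\ exists K, forall x, `|h x| <= K.

Lemma bmeas_integrable (d : measure_display) (T : measurableType d) (R : realType)
    (mu : probability T R) (h : T -> R) :
  bounded_meas h -> mu.-integrable [set: T] (EFin \o h).
Proof.
move=> [mh [K hK]]; apply: measurable_bounded_integrable => //.
  by rewrite (le_lt_trans (probability_le1 mu measurableT))// ltry.
by exists K; split; [exact: num_real|move=> M KM x _ /=; exact: le_trans (hK x) (ltW KM)].
Qed.

Lemma EFin_Rint (d : measure_display) (T : measurableType d) (R : realType)
    (mu : probability T R) (h : T -> R) :
  bounded_meas h -> (\int[mu]_x (h x)%:E)%E = (\int[mu]_x h x)%:E.
Proof.
by move=> hb; rewrite /Rintegral fineK// integrable_fin_num//; exact: bmeas_integrable.
Qed.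

Lemma bmeas_cst (d : measure_display) (T : measurableType d) (R : realType) (c : R) :
  bounded_meas (fun _ : T => c).
Proof. by split; [exact: measurable_cst|exists `|c|]. Qed.

Lemma bmeasD (d : measure_display) (T : measurableType d) (R : realType) (f g : T -> R) :
  bounded_meas f -> bounded_meas g -> bounded_meas (fun x => f x + g x).
Proof.
move=> [mf [K hK]] [mg [L hL]]; split; first exact: measurable_funD.
by exists (K + L) => x; rewrite (le_trans (ler_normD _ _))// lerD.
Qed.

Lemma bmeasZ (d : measure_display) (T : measurableType d) (R : realType) (c : R) (f : T -> R) :
  bounded_meas f -> bounded_meas (fun x => c * f x).
Proof.
move=> [mf [K hK]]; split; first exact: measurable_funM.
by exists (`|c| * K) => x; rewrite normrM ler_wpM2l.
Qed.

Lemma bmeas_sum (d : measure_display) (T : measurableType d) (R : realType)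
    (h : nat -> T -> R) n :
  (forall i, bounded_meas (h i)) -> bounded_meas (fun x => \sum_(i < n) h i x).
Proof.
move=> hb; elim: n => [|n IH].
  by under eq_fun do rewrite big_ord0; exact: bmeas_cst.
by under eq_fun do rewrite big_ord_recr /=; exact: bmeasD.
Qed.

Lemma bmeas_indic (d : measure_display) (T : measurableType d) (R : realType) (A : set T) :
  measurable A -> bounded_meas (fun x => \1_A x : R).
Proof.
move=> mA; split; first exact: measurable_indic.
by exists 1 => x; rewrite indicE; case: (_ \in _); rewrite ?normr1// normr0.
Qed.

Lemma bmeas_comp (d d' : measure_display) (T : measurableType d) (U : measurableType d')
    (R : realType) (h : U -> R) (S : T -> U) :
  measurable_fun [set: T] S -> bounded_meas h -> bounded_meas (fun x => h (S x)).
Proof.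
by move=> mS [mh [K hK]]; split; [exact: measurableT_comp|exists K].
Qed.

Lemma RintD (d : measure_display) (T : measurableType d) (R : realType)
    (mu : probability T R) (f g : T -> R) : bounded_meas f -> bounded_meas g ->
  \int[mu]_x (f x + g x) = \int[mu]_x f x + \int[mu]_x g x.
Proof. by move=> hf hg; rewrite RintegralD//; exact: bmeas_integrable. Qed.

Lemma RintZ (d : measure_display) (T : measurableType d) (R : realType)
    (mu : probability T R) (c : R) (f : T -> R) : bounded_meas f ->
  \int[mu]_x (c * f x) = c * \int[mu]_x f x.
Proof. by move=> hf; rewrite RintegralZl//; exact: bmeas_integrable. Qed.

Lemma Rint_cst (d : measure_display) (T : measurableType d) (R : realType)
    (mu : probability T R) (c : R) : \int[mu]_x c = c.
Proof.
rewrite Rintegral_cst// -[RHS]mulr1; congr (_ * _).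
exact: (congr1 fine (probability_setT mu)).
Qed.

Lemma Rint_sum (d : measure_display) (T : measurableType d) (R : realType)
    (mu : probability T R) (h : nat -> T -> R) n : (forall i, bounded_meas (h i)) ->
  \int[mu]_x (\sum_(i < n) h i x) = \sum_(i < n) \int[mu]_x h i x.
Proof.
move=> hb; elim: n => [|n IH].
  by under eq_Rintegral do rewrite big_ord0; rewrite Rint_cst big_ord0.
under eq_Rintegral do rewrite big_ord_recr /=.
by rewrite RintD ?IH ?big_ord_recr//; exact: bmeas_sum.
Qed.

Lemma le_Rint (d : measure_display) (T : measurableType d) (R : realType)
    (mu : probability T R) (f g : T -> R) : bounded_meas f -> bounded_meas g ->
  (forall x, f x <= g x) -> \int[mu]_x f x <= \int[mu]_x g x.
Proof.
by move=> hf hg fg; apply: le_Rintegral => //; exact: bmeas_integrable.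
Qed.

Lemma Rint_indic (d : measure_display) (T : measurableType d) (R : realType)
    (mu : probability T R) (A : set T) : measurable A ->
  \int[mu]_x (\1_A x : R) = fine (mu A).
Proof. by move=> mA; rewrite /Rintegral integral_indic// setIT. Qed.

Lemma Rint_cvg_cst (d : measure_display) (T : measurableType d) (R : realType)
    (mu : probability T R) (h : nat -> T -> R) (K l : R) :
  (forall n, measurable_fun [set: T] (h n)) -> (forall n x, `|h n x| <= K) ->
  {ae mu, forall x, h n x @[n --> \oo] --> l} ->
  \int[mu]_x h n x @[n --> \oo] --> l.
Proof.
move=> mh hK hl.
have hb n : bounded_meas (h n) by split=> //; exists K.
have [] := @dominated_convergence _ T R mu setT measurableT
   (fun n x => (h n x)%:E) (cst l%:E) (cst K%:E).
- by move=> n; exact/measurable_EFinP.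
- exact: measurable_cst.
- by apply: filterS hl => x hx _; apply/cvg_EFin; [exact: nearW|exact: hx].
- exact: (bmeas_integrable mu (bmeas_cst T K)).
- by apply: aeW => x n _; rewrite /= lee_fin.
have muT : (mu [set: T] : \bar R) = 1%E := probability_setT mu.
move=> _ _; rewrite integral_cst// [X in (_ * X)%E]muT mule1 => cl.
exact: (fine_cvg cl).
Qed.

(** Through the push-forward measure, which agrees with P on measurable sets. *)
Lemma Rint_invariant (d : measure_display) (Omega : measurableType d) (R : realType)
    (P : probability Omega R) (T : Omega -> Omega) (h : Omega -> R) :
  measure_preserving P T -> bounded_meas h -> \int[P]_x h (T x) = \int[P]_x h x.
Proof.
move=> [mT PT] hb; rewrite /Rintegral; congr fine.
have := @integral_pushforward _ _ _ _ R T mT P setT (EFin \o h).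
rewrite preimage_setT => /(_ _ _ measurableT) <-.
- by apply: eq_measure_integral => A mA _; exact: PT.
- by apply/measurable_EFinP; case: hb.
- exact: (bmeas_integrable P (bmeas_comp mT hb)).
Qed.

Lemma measure_preserving_iter (d : measure_display) (Omega : measurableType d) (R : realType)
    (P : probability Omega R) (T : Omega -> Omega) n :
  measure_preserving P T -> measure_preserving P (iter n T).
Proof.
move=> [mT PT]; elim: n => [|n [mn Pn]]; first by split=> //; exact: measurable_id.
split; first exact: (measurableT_comp mT mn).
by move=> A mA; rewrite -[RHS]PT// -[RHS]Pn// -[T @^-1` A]setTI; exact: mT.
Qed.

(** * The logarithmic potential of the density of states *)

(** The derivative only controls small h; for the others the measure is at most
    one. *)
Lemma symmetric_derivative_bound (R : realType)
    (nu : probability (measurableTypeR R) R) (E D : R) :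
  has_symmetric_derivative nu E D ->
  exists2 C : R, 0 < C & forall h, 0 < h ->
    (fine (nu `](E - h)%R, (E + h)%R[%classic) <= C * h).
Proof.
move=> hD; pose m h := fine (nu `](E - h)%R, (E + h)%R[%classic).
have mE h : nu `](E - h)%R, (E + h)%R[%classic = (m h)%:E.
  by rewrite fineK// fin_num_measure.
have m1 h : m h <= 1.
  by rewrite -lee_fin -mE probability_le1.
have hD' : m h * (2 * h)^-1 @[h --> (0 : R)^'+] --> D.
  have hE : (m h * (2 * h)^-1)%:E @[h --> (0 : R)^'+] --> D%:E.
    by under eq_fun do rewrite EFinM -mE; exact: hD.
  exact: (fine_cvg hE).
have lt1 : D < `|D| + 1 by rewrite (le_lt_trans (ler_norm D))// ltrDl.
have [e /= e0 he] := cvgr_lt _ hD' _ lt1.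
have C0 : 0 < Num.max (2 * (`|D| + 1)) (2 / e).
  by rewrite lt_max mulr_gt0// ltr_wpDl.
exists (Num.max (2 * (`|D| + 1)) (2 / e)) => // h h0; rewrite -/(m h).
have [he2|he2] := ltP h e.
  have := he h; rewrite /= sub0r normrN gtr0_norm// => /(_ he2 h0).
  rewrite ltr_pdivrMr ?mulr_gt0// => /ltW /le_trans; apply.
  by rewrite mulrA ler_wpM2r ?(ltW h0)// mulrC le_max lexx.
apply: (le_trans (m1 h)); apply: (@le_trans _ _ (2 / e * h)).
  by rewrite mulrAC ler_pdivlMr// mul1r; lra.
by rewrite ler_wpM2r ?(ltW h0)// le_max lexx orbT.
Qed.

Lemma cont_meas (R : realType) (f : R -> R) : continuous f ->
  measurable_fun [set: measurableTypeR R] f.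
Proof. exact: continuous_measurable_fun. Qed.

Lemma poisson_bmeas (R : realType) (E e : R) : 0 < e ->
  bounded_meas (fun x : measurableTypeR R => e ^+ 2 / ((x - E) ^+ 2 + e ^+ 2) : R).
Proof.
move=> e0; have q0 (x : R) : 0 < (x - E) ^+ 2 + e ^+ 2.
  by rewrite ltr_wpDl ?sqr_ge0// exprn_gt0.
split.
  apply: cont_meas => x; apply: cvgM; first exact: cvg_cst.
  apply: cvgV; first by rewrite gt_eqF.
  apply: cvgD; last exact: cvg_cst.
  rewrite expr2; under eq_fun do rewrite expr2.
  by apply: cvgM; apply: cvgB; [exact: cvg_id|exact: cvg_cst|exact: cvg_id|exact: cvg_cst].
exists 1 => x; rewrite ger0_norm ?divr_ge0 ?sqr_ge0 ?(ltW (q0 x))//.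
by rewrite ler_pdivrMr// mul1r lerDr sqr_ge0.
Qed.

(** Let I(e) be the integral. The Poisson kernel at scale e is at most the
    indicator of |x - E| < 2 e plus 2/5 of the kernel at scale 2 e, so that
    I(e) <= 2 C e + (2/5) I(2 e), and a bound K (2 e) at scale 2 e gives K e at
    scale e as soon as K >= 10 C. The recursion starts from the scales above
    one, where I(e) <= 1. *)
Lemma poisson_bound (R : realType) (nu : probability (measurableTypeR R) R) (E D : R) :
  has_symmetric_derivative nu E D ->
  exists2 K : R, 0 < K & forall e, 0 < e ->
    \int[nu]_x (e ^+ 2 / ((x - E) ^+ 2 + e ^+ 2)) <= K * e.
Proof.
move=> /symmetric_derivative_bound[C C0 hC].
have q0 e (x : R) : 0 < e -> 0 < (x - E) ^+ 2 + e ^+ 2.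
  by move=> e0; rewrite ltr_wpDl ?sqr_ge0// exprn_gt0.
(* K = 1 serves the scales above one, K = 10 C the induction. *)
pose K := Num.max 1 (10 * C); have K1 : 1 <= K by rewrite le_max lexx.
have KC : 10 * C <= K by rewrite le_max lexx orbT.
exists K; first lra.
suff main k e : 0 < e -> 1 <= 2 ^+ k * e ->
    \int[nu]_x (e ^+ 2 / ((x - E) ^+ 2 + e ^+ 2)) <= K * e.
  move=> e e0; have [k hk] : exists k : nat, e^-1 <= 2 ^+ k.
    exists (Num.Def.archi_bound e^-1); apply/ltW.
    apply: lt_le_trans (archi_boundP (ltW _)) _; first by rewrite invr_gt0.
    by rewrite -natrX ler_nat ltnW// ltn_expl.
  by apply: (main k) => //; rewrite -ler_pdivrMr// div1r.
elim: k e => [|k IH] e e0.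
  rewrite expr0 mul1r => e1; apply: (@le_trans _ _ 1); last by nra.
  rewrite -[leRHS](Rint_cst nu); apply: le_Rint; first exact: poisson_bmeas.
    exact: bmeas_cst.
  by move=> x; rewrite ler_pdivrMr ?q0// mul1r lerDr sqr_ge0.
move=> hk; have e20 : 0 < 2 * e by rewrite mulr_gt0.
have := IH (2 * e) e20; rewrite mulrA -exprSr => /(_ hk) I2.
set A : set (measurableTypeR R) := `](E - 2 * e)%R, (E + 2 * e)%R[%classic.
have mA : measurable A by exact: measurable_itv.
apply: (@le_trans _ _ (\int[nu]_x (\1_A x +
    2 / 5 * ((2 * e) ^+ 2 / ((x - E) ^+ 2 + (2 * e) ^+ 2))))).
  apply: le_Rint; first exact: poisson_bmeas.
    by apply: bmeasD; [exact: bmeas_indic|apply: bmeasZ; exact: poisson_bmeas].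
  move=> x; rewrite indicE; have [xA|xA] := boolP (x \in A).
    apply: (@le_trans _ _ 1); first by rewrite ler_pdivrMr ?q0// mul1r lerDr sqr_ge0.
    by rewrite lerDl mulr_ge0// divr_ge0 ?sqr_ge0// ltW// q0.
  rewrite add0r mulrA ler_pdivrMr ?q0// mulrAC ler_pdivlMr ?q0//.
  have : (2 * e) ^+ 2 <= (x - E) ^+ 2.
    have : ~ (E - 2 * e < x < E + 2 * e).
      by move=> h; move: xA; rewrite notin_setE; apply; rewrite /A /= in_itv.
    move=> /negP; rewrite negb_and -!leNgt => /orP[h|h]; nra.
  have := sqr_ge0 e; have := sqr_ge0 (x - E).
  have -> : (2 * e) ^+ 2 = 4 * e ^+ 2 by ring.
  move: ((x - E) ^+ 2) (e ^+ 2) => u v; nra.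
rewrite RintD; [|exact: bmeas_indic|by apply: bmeasZ; exact: poisson_bmeas].
rewrite RintZ; last exact: poisson_bmeas.
rewrite Rint_indic//; have := hC _ e20; rewrite -/A; nra.
Qed.

Section log_ratio.
Context (R : realType) (E eps del : R).
Hypotheses (e0 : 0 < eps) (d0 : 0 < del).

Let q0 e (x : R) : 0 < e -> 0 < (x - E) ^+ 2 + e ^+ 2.
Proof. by move=> h; rewrite ltr_wpDl ?sqr_ge0// exprn_gt0. Qed.

Lemma log_ratio_continuous : continuous (log_ratio E eps del).
Proof.
move=> x; have h e : 0 < e -> {for x, continuous (fun y : R => ln ((y - E) ^+ 2 + e ^+ 2))}.
  move=> h; apply: (@continuous_comp _ _ _ (fun y : R => (y - E) ^+ 2 + e ^+ 2) (@ln R)).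
    apply: cvgD; last exact: cvg_cst.
    rewrite expr2; under eq_fun do rewrite expr2.
    by apply: cvgM; apply: cvgB; [exact: cvg_id|exact: cvg_cst|exact: cvg_id|exact: cvg_cst].
  by apply: continuous_ln; exact: q0.
by apply: cvgB; exact: h.
Qed.

Lemma log_ratio_ge0 x : del <= eps -> 0 <= log_ratio E eps del x.
Proof.
move=> de; rewrite subr_ge0 ler_ln ?posrE ?q0// lerD2l ler_pXn2r ?nnegrE// ltW//.
Qed.

Lemma log_ratio_le x : del <= eps -> log_ratio E eps del x <= 2 * ln (eps / del).
Proof.
move=> de; have ed : 0 < eps / del by rewrite divr_gt0.
rewrite /log_ratio -ln_div ?posrE ?q0// mulr_natl -lnXn// ler_ln ?posrE ?divr_gt0 ?q0 ?exprn_gt0//.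
rewrite ler_pdivrMr ?q0//.
have -> : (eps / del) ^+ 2 * ((x - E) ^+ 2 + del ^+ 2) =
    (eps / del) ^+ 2 * (x - E) ^+ 2 + eps ^+ 2 by field; rewrite gt_eqF.
rewrite lerD2r -[leLHS]mul1r ler_wpM2r ?sqr_ge0//.
by rewrite exprn_ege1// ler_pdivlMr// mul1r.
Qed.

Lemma log_ratio_bmeas : del <= eps -> bounded_meas (log_ratio E eps del : measurableTypeR R -> R).
Proof.
move=> de; split; first by apply: cont_meas; exact: log_ratio_continuous.
by exists (2 * ln (eps / del)) => x; rewrite ger0_norm ?log_ratio_ge0// log_ratio_le.
Qed.

End log_ratio.

(** From ln r <= r - 1; halving eps compares with a Poisson kernel. *)
Lemma log_ratio_half (R : realType) (E e x : R) : 0 < e ->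
  log_ratio E e (e / 2) x <= 3 * (e ^+ 2 / ((x - E) ^+ 2 + e ^+ 2)).
Proof.
move=> e0; have h0 : 0 < e / 2 by rewrite divr_gt0.
have q1 : 0 < (x - E) ^+ 2 + e ^+ 2 by rewrite ltr_wpDl ?sqr_ge0// exprn_gt0.
have q2 : 0 < (x - E) ^+ 2 + (e / 2) ^+ 2 by rewrite ltr_wpDl ?sqr_ge0// exprn_gt0.
rewrite /log_ratio -ln_div ?posrE//.
have := @le_ln1Dx R (((x - E) ^+ 2 + e ^+ 2) / ((x - E) ^+ 2 + (e / 2) ^+ 2) - 1).
rewrite (addrC 1) subrK => /(_ _)/le_trans; apply.
  by rewrite ltrBrDl addrN divr_gt0.
rewrite mulrA lerBlDr ler_pdivrMr// mulrDl mul1r mulrAC -lerBlDr ler_pdivlMr//.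
have := sqr_ge0 (x - E); have := sqr_ge0 e.
have -> : (e / 2) ^+ 2 = e ^+ 2 / 4 by field.
move: ((x - E) ^+ 2) (e ^+ 2) => u v; nra.
Qed.

(** The logarithmic ratio between eps and del is cut into halvings of eps. The
    halving at scale e costs at most 3 K e, and the scales form a geometric
    series. *)
Lemma log_ratio_bound (R : realType) (nu : probability (measurableTypeR R) R) (E D : R) :
  has_symmetric_derivative nu E D ->
  exists2 K : R, 0 < K & forall eps del, 0 < del -> del <= eps ->
    \int[nu]_x (log_ratio E eps del x) <= K * eps.
Proof.
move=> /poisson_bound[K K0 hK]; exists (6 * K); first by rewrite mulr_gt0.
have half e : 0 < e -> \int[nu]_x (log_ratio E e (e / 2) x) <= 3 * K * e.
  move=> e0; have h0 : 0 < e / 2 by rewrite divr_gt0.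
  apply: (@le_trans _ _ (\int[nu]_x (3 * (e ^+ 2 / ((x - E) ^+ 2 + e ^+ 2))))).
    apply: le_Rint; first by apply: log_ratio_bmeas => //; lra.
      by apply: bmeasZ; exact: poisson_bmeas.
    by move=> x; exact: log_ratio_half.
  rewrite RintZ; last exact: poisson_bmeas.
  by rewrite -[leRHS]mulrA ler_wpM2l// hK.
suff main k eps del : 0 < del -> del <= eps -> eps <= 2 ^+ k * del ->
    \int[nu]_x (log_ratio E eps del x) <= 6 * K * eps.
  move=> eps del d0 de; have [k hk] : exists k : nat, eps / del <= 2 ^+ k.
    exists (Num.Def.archi_bound (eps / del)); apply/ltW.
    apply: lt_le_trans (archi_boundP _) _; first by rewrite divr_ge0// ltW// (lt_le_trans d0).
    by rewrite -natrX ler_nat ltnW// ltn_expl.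
  by apply: (main k) => //; rewrite -ler_pdivrMr.
elim: k eps del => [|k IH] eps del d0 de hk.
  have -> : eps = del by apply/eqP; rewrite eq_le de andbT; move: hk; rewrite expr0 mul1r.
  have -> : \int[nu]_x (log_ratio E del del x) = 0.
    by under eq_Rintegral do rewrite /log_ratio subrr; exact: Rint_cst.
  by rewrite !mulr_ge0// ltW.
have e0 : 0 < eps by exact: lt_le_trans de.
have h0 : 0 < eps / 2 by rewrite divr_gt0.
have [de2|de2] := leP del (eps / 2).
  have -> : \int[nu]_x (log_ratio E eps del x) =
      \int[nu]_x (log_ratio E eps (eps / 2) x + log_ratio E (eps / 2) del x).
    by apply: eq_Rintegral => x _; rewrite /log_ratio; ring.
  rewrite RintD; [|by apply: log_ratio_bmeas => //; lra|exact: log_ratio_bmeas].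
  have := half _ e0; have := IH (eps / 2) del d0 de2.
  rewrite ler_pdivrMr// mulrAC -exprSr => /(_ hk); lra.
apply: (@le_trans _ _ (\int[nu]_x (log_ratio E eps (eps / 2) x))); last first.
  by apply: le_trans (half _ e0) _; rewrite !ler_wpM2r ?(ltW e0) ?(ltW K0)//; lra.
apply: le_Rint; [exact: log_ratio_bmeas|by apply: log_ratio_bmeas => //; lra|move=> x].
rewrite /log_ratio lerD2l lerN2 ler_ln ?posrE; last 2 first.
- by rewrite ltr_wpDl ?sqr_ge0// exprn_gt0.
- by rewrite ltr_wpDl ?sqr_ge0// exprn_gt0.
by rewrite lerD2l ler_pXn2r ?nnegrE// ltW.
Qed.

(** * Measurability of the solutions *)

Lemma orbit_shift (Omega : Type) (R : realType) (T : Omega -> Omega) (F : Omega -> R) w n :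
  shift_seq n (orbit_seq T F w) = orbit_seq T F (iter n T w).
Proof.
by apply: funext => k; rewrite /shift_seq /orbit_seq addnC iterD.
Qed.

Lemma bounded_coefficients (Omega : Type) (R : realType) (T : Omega -> Omega)
    (f g : Omega -> R) :
  (forall w, 0 < f w) -> bounded_fun f -> bounded_fun g ->
  exists2 A : R, 0 < A & forall w k,
    0 < orbit_seq T f w k <= A /\ `|orbit_seq T g w k| <= A.
Proof.
move=> f0 [M1 [_ h1]] [M2 [_ h2]].
pose A := `|M1| + `|M2| + 1; have A0 : 0 < A by rewrite ltr_wpDl// addr_ge0.
have A1 : M1 < A by rewrite /A; have := ler_norm M1; have := normr_ge0 M2; lra.
have A2 : M2 < A by rewrite /A; have := ler_norm M2; have := normr_ge0 M1; lra.
exists A => // w k; rewrite /orbit_seq f0; split; last exact: (h2 A A2 _ Logic.I).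
exact: le_trans (ler_norm _) (h1 A A1 _ Logic.I).
Qed.

Lemma measurable_rcomp (d : measure_display) (T : measurableType d) (R : realType)
    (h : R -> R) (k : T -> R) :
  measurable_fun [set: R] h -> measurable_fun [set: T] k ->
  measurable_fun [set: T] (fun x => h (k x)).
Proof. exact: measurableT_comp. Qed.

Section measurability.
Context (d : measure_display) (Omega : measurableType d) (R : realType)
  (T : Omega -> Omega) (f g : Omega -> R).
Hypotheses (mT : measurable_fun [set: Omega] T) (f_pos : forall w, 0 < f w)
  (mf : measurable_fun [set: Omega] f) (mg : measurable_fun [set: Omega] g).

Lemma measurable_orbit (F : Omega -> R) n : measurable_fun [set: Omega] F ->
  measurable_fun [set: Omega] (fun w => orbit_seq T F w n).
Proof.
move=> mF; apply: (measurableT_comp mF).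
elim: n => [|n IH]; first exact: measurable_id.
exact: (measurableT_comp mT IH).
Qed.

(** The inverse of a positive function is exp (- ln). *)
Lemma measurable_orbitV n :
  measurable_fun [set: Omega] (fun w => (orbit_seq T f w n)^-1).
Proof.
have -> : (fun w => (orbit_seq T f w n)^-1) = (fun w => expR (- ln (orbit_seq T f w n))).
  by apply: funext => w; rewrite expRN lnK// posrE; exact: f_pos.
apply: (measurable_rcomp (@measurable_expR R)); apply: measurable_funN.
by apply: (measurable_rcomp (@measurable_ln R)); exact: measurable_orbit.
Qed.

Lemma measurable_jacobi_sol (E u c : R) n :
  measurable_fun [set: Omega]
    (fun w => (jacobi_sol (orbit_seq T f w) (orbit_seq T g w) E u c n).1) /\
  measurable_fun [set: Omega]
    (fun w => (jacobi_sol (orbit_seq T f w) (orbit_seq T g w) E u c n).2).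
Proof.
elim: n => [|n [IH1 IH2]]; first by split; exact: measurable_cst.
split; last by apply: measurable_funM => //; exact: measurable_orbit.
apply: measurable_funM; last exact: measurable_orbitV.
apply: measurable_funB => //; apply: measurable_funM => //.
by apply: measurable_funB; [exact: measurable_cst|exact: measurable_orbit].
Qed.

Lemma measurable_jacobi_sol_complex (z : R[i]) n :
  let s w := jacobi_sol (cseq (orbit_seq T f w)) (cseq (orbit_seq T g w)) z 1 0 n in
  [/\ measurable_fun [set: Omega] (fun w => Re (s w).1),
      measurable_fun [set: Omega] (fun w => Im (s w).1),
      measurable_fun [set: Omega] (fun w => Re (s w).2) &
      measurable_fun [set: Omega] (fun w => Im (s w).2)].
Proof.
elim: n => [|n [m1 m2 m3 m4]] /=; first by split; exact: measurable_cst.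
have ma := measurable_orbit n.+1 mf; have mb := measurable_orbit n.+1 mg.
have mv := measurable_orbitV n.+1.
have eq1 (x y : R[i]) (a b : R) :
    ((z - real_complex R b) * x - y) / real_complex R a =
    Complex (((Re z - b) * Re x - Im z * Im x - Re y) * a^-1)
            (((Re z - b) * Im x + Im z * Re x - Im y) * a^-1).
  rewrite -fmorphV; case: (z) x y => [z1 z2] [x1 x2] [y1 y2] /=.
  by apply/eqP; rewrite eq_complex /=; apply/andP; split; apply/eqP; ring.
have eq2 (x : R[i]) (a : R) : real_complex R a * x = Complex (a * Re x) (a * Im x).
  by case: x => x1 x2; apply/eqP; rewrite eq_complex /=; apply/andP; split; apply/eqP; ring.
have mzb : measurable_fun [set: Omega] (fun w => Re z - orbit_seq T g w n.+1).
  by apply: measurable_funB => //; exact: measurable_cst.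
have mZ (h : Omega -> R) c : measurable_fun [set: Omega] h ->
    measurable_fun [set: Omega] (fun w => c * h w).
  by move=> mh; apply: measurable_funM => //; exact: measurable_cst.
split; rewrite /cseq.
- under eq_fun do rewrite eq1 /=; apply: measurable_funM => //.
  apply: measurable_funB => //; apply: measurable_funB; last exact: mZ.
  exact: measurable_funM.
- under eq_fun do rewrite eq1 /=; apply: measurable_funM => //.
  apply: measurable_funB => //; apply: measurable_funD; last exact: mZ.
  exact: measurable_funM.
- by under eq_fun do rewrite eq2 /=; apply: measurable_funM.
- by under eq_fun do rewrite eq2 /=; apply: measurable_funM.
Qed.

Lemma measurable_ln_sqmod_psol (E t : R) n :
  measurable_fun [set: Omega]
    (fun w => ln_sqmod_psol (orbit_seq T f w) (orbit_seq T g w) E t n).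
Proof.
have [m1 m2 _ _] := measurable_jacobi_sol_complex (Complex E t) n.
apply: (measurable_rcomp (@measurable_ln R)); rewrite /sqmod /psol.
under eq_fun do rewrite !expr2.
by apply: measurable_funD; apply: measurable_funM.
Qed.

Lemma measurable_sqrt_gram (E : R) n :
  measurable_fun [set: Omega]
    (fun w => sqrt_gram (orbit_seq T f w) (orbit_seq T g w) E n).
Proof.
have -> : (fun w => sqrt_gram (orbit_seq T f w) (orbit_seq T g w) E n) =
   (fun w => Num.sqrt (gram_det (psol (orbit_seq T f w) (orbit_seq T g w) E)
      (qsol (orbit_seq T f w) (orbit_seq T g w) E) n)).
  by apply: funext => w; rewrite sqrt_gramE.
have mp i : measurable_fun [set: Omega] (fun w => psol (orbit_seq T f w) (orbit_seq T g w) E i).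
  by have [] := measurable_jacobi_sol E 1 0 i.
have mq i : measurable_fun [set: Omega] (fun w => qsol (orbit_seq T f w) (orbit_seq T g w) E i).
  by have [] := measurable_jacobi_sol E 0 (-1) i.
have ms (h : nat -> Omega -> R) : (forall i, measurable_fun [set: Omega] (h i)) ->
    measurable_fun [set: Omega] (fun w => \sum_(i < n) h i w).
  move=> mh; elim: (n) => [|m IH].
    by under eq_fun do rewrite big_ord0; exact: measurable_cst.
  by under eq_fun do rewrite big_ord_recr /=; exact: measurable_funD.
have msq : measurable_fun [set: R] (@Num.sqrt R).
  by apply: continuous_measurable_fun; exact: sqrt_continuous.
apply: (measurable_rcomp msq); rewrite /gram_det.
under eq_fun do rewrite [X in _ - X]expr2.
pose p i w := psol (orbit_seq T f w) (orbit_seq T g w) E i.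
pose q i w := qsol (orbit_seq T f w) (orbit_seq T g w) E i.
have mpp : measurable_fun [set: Omega] (fun w => \sum_(i < n) p i w ^+ 2).
  by apply: (ms (fun i w => p i w ^+ 2)) => i; exact: (measurable_funX _ (mp i)).
have mqq : measurable_fun [set: Omega] (fun w => \sum_(i < n) q i w ^+ 2).
  by apply: (ms (fun i w => q i w ^+ 2)) => i; exact: (measurable_funX _ (mq i)).
have mpq : measurable_fun [set: Omega] (fun w => \sum_(i < n) p i w * q i w).
  by apply: (ms (fun i w => p i w * q i w)) => i; exact: (measurable_funM (mp i) (mq i)).
by apply: measurable_funB; exact: measurable_funM.
Qed.

End measurability.

(** * Mean growth at complex energies *)

Lemma integral_zero_counting (R : realType) (a b : nat -> R) (n : nat) (h : R -> R) :
  (forall x, 0 <= h x) -> measurable_fun [set: measurableTypeR R] h ->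
  (\int[zero_counting a b n]_x (h x)%:E)%E =
  (n%:R^-1 * \sum_(x <- rootsR (orthopoly a b n)) h x)%:E.
Proof.
move=> h0 mh; rewrite /zero_counting.
have mh' : measurable_fun [set: measurableTypeR R] (EFin \o h) by exact/measurable_EFinP.
have h0' x : [set: measurableTypeR R] x -> (0 <= (h x)%:E)%E by rewrite lee_fin.
rewrite ge0_integral_mscale//= ge0_integral_measure_sum//= EFinM; congr (_ * _)%E.
rewrite (big_nth 0) big_mkord -sumEFin; apply: eq_bigr => i _.
by rewrite integral_dirac// diracT mul1e.
Qed.

Lemma potential_diff_bounds (R : realType) (a b : nat -> R) (E eps del : R) n :
  (forall k, 0 < a k) -> 0 < del -> del <= eps ->
  0 <= potential_diff a b E eps del n <= n%:R * (2 * ln (eps / del)).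
Proof.
move=> ha d0 de; have e0 : 0 < eps by exact: lt_le_trans de.
rewrite potential_diff_roots//; apply/andP; split.
  by apply: sumr_ge0 => x _; exact: log_ratio_ge0.
have [_ sz] := orthopoly_split b n ha.
apply: (@le_trans _ _ (\sum_(x <- rootsR (orthopoly a b n)) 2 * ln (eps / del))).
  by apply: ler_sum => x _; exact: log_ratio_le.
by rewrite big_const_seq count_predT sz iter_addr_0 -[leLHS]mulr_natl.
Qed.

Section mean.
Context (d : measure_display) (Omega : measurableType d) (R : realType)
  (P : probability Omega R) (T : Omega -> Omega) (f g : Omega -> R)
  (E A : R).
Hypotheses (pT : measure_preserving P T)
  (mf : measurable_fun [set: Omega] f) (mg : measurable_fun [set: Omega] g)
  (hA : forall w k, 0 < orbit_seq T f w k <= A /\ `|orbit_seq T g w k| <= A).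

Let a w := orbit_seq T f w.
Let b w := orbit_seq T g w.
Let a0 w k : 0 < a w k. Proof. by have [/andP[]] := hA w k. Qed.

Lemma bmeas_potential_diff eps del n : 0 < del -> del <= eps ->
  bounded_meas (fun w => potential_diff (a w) (b w) E eps del n).
Proof.
move=> d0 de; have f0 w : 0 < f w by exact: (a0 w 0%N).
split; last first.
  exists (n%:R * (2 * ln (eps / del))) => w.
  by have /andP[h1 h2] := potential_diff_bounds (b w) E n (a0 w) d0 de; rewrite ger0_norm.
by have [mT _] := pT; apply: measurable_funB; exact: measurable_ln_sqmod_psol.
Qed.

Definition cut_cost (eps del : R) : R :=
  `|ln ((4 * (E ^+ 2 + eps ^+ 2) + 4 * A ^+ 2 + 2 * A ^+ 4 / eps ^+ 2) / eps ^+ 2)|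
  + ln (2 + 2 * A ^+ 4 / del ^+ 4).

Lemma cut_cost_ge0 eps del : 0 < del -> 0 < A -> 0 <= cut_cost eps del.
Proof.
move=> d0 A0; rewrite addr_ge0// ln_ge0//.
have : 0 <= 2 * A ^+ 4 / del ^+ 4 by rewrite divr_ge0 ?mulr_ge0 ?exprn_ge0// ltW.
lra.
Qed.

(** A window of length (k + 1) N is cut into k + 1 windows of length N, whose
    means coincide by invariance. *)
Lemma mean_potential_diff_superadd eps del N k : 0 < del -> del <= eps -> (0 < N)%N -> 0 < A ->
  k.+1%:R * \int[P]_w (potential_diff (a w) (b w) E eps del N) <=
  \int[P]_w (potential_diff (a w) (b w) E eps del (k.+1 * N)) + k%:R * cut_cost eps del.
Proof.
move=> d0 de N0 A0; have e0 : 0 < eps by exact: lt_le_trans de.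
have c0 := cut_cost_ge0 eps d0 A0.
pose F n w := potential_diff (a w) (b w) E eps del n; pose G n := \int[P]_w F n w.
rewrite -/(G N) -/(G _); have bF n : bounded_meas (F n) by exact: bmeas_potential_diff.
have step n m : (0 < m)%N -> G n + G m <= G (n + m)%N + cut_cost eps del.
  move=> m0; have pTn := measure_preserving_iter n pT.
  have bFT : bounded_meas (fun w => F m (iter n T w)) by case: (pTn) => mTn _; exact: bmeas_comp.
  rewrite {2}/G -(Rint_invariant pTn)// -RintD// -[cut_cost _ _](Rint_cst P) -RintD//;
    last exact: bmeas_cst.
  apply: le_Rint; [exact: bmeasD|by apply: bmeasD => //; exact: bmeas_cst|move=> w].
  rewrite /F /a /b -!orbit_shift -/(a w) -/(b w).
  apply: (le_trans (potential_diff_superadd n E e0 d0 (fun k => (hA w k).1) (fun k => (hA w k).2) m0)).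
  by rewrite -addrA lerD2l lerD2r ler_norm.
elim: k => [|k IH]; first by rewrite mul1n mul1r mul0r addr0.
have := step N (k.+1 * N)%N; rewrite muln_gt0 N0 /= -mulSn => /(_ isT) h.
rewrite -[k.+2%:R]natr1 -[X in _ <= _ + X * _]natr1; lra.
Qed.

(** Divide the inequality for k + 1 windows by k + 1 and let k grow: the mean per
    site over a very long window is the mean of the integral of log_ratio
    against the zero counting measure, and dominated convergence applies as
    log_ratio is bounded. *)
Lemma mean_potential_diff_le (nu : probability (measurableTypeR R) R) eps del N :
  is_density_of_states P T f g nu ->
  0 < del -> del <= eps -> (0 < N)%N -> 0 < A ->
  \int[P]_w (potential_diff (a w) (b w) E eps del N) <=
  N%:R * \int[nu]_x (log_ratio E eps del x) + cut_cost eps del.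
Proof.
move=> hnu d0 de N0 A0; have e0 : 0 < eps by exact: lt_le_trans de.
have c0 := cut_cost_ge0 eps d0 A0.
have NR : 0 < N%:R :> R by rewrite ltr0n.
pose h k w := (k.+1 * N)%:R^-1 * potential_diff (a w) (b w) E eps del (k.+1 * N).
have hcvg : \int[P]_w h k w @[k --> \oo] --> \int[nu]_x (log_ratio E eps del x).
  apply: (@Rint_cvg_cst _ _ _ _ _ (2 * ln (eps / del))).
  - by move=> n; have [] := bmeasZ ((n.+1 * N)%:R^-1) (bmeas_potential_diff (n.+1 * N) d0 de).
  - move=> n w; have := potential_diff_bounds (b w) E (n.+1 * N) (a0 w) d0 de.
    have MR : 0 < (n.+1 * N)%:R :> R by rewrite ltr0n muln_gt0.
    move=> /andP[h1 h2]; rewrite /h ger0_norm ?mulr_ge0 ?invr_ge0 ?(ltW MR)//.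
    by rewrite mulrC ler_pdivrMr// mulrC.
  apply: filterS hnu => w hw.
  have cphi := @log_ratio_continuous R E _ _ e0 d0; have bphi := @log_ratio_bmeas R E _ _ e0 d0 de.
  have := hw (log_ratio E eps del) cphi _.
  have [mphi [K hK]] := bphi.
  have bdd : bounded_fun (log_ratio E eps del).
    by exists K; split; [exact: num_real|move=> M KM x _ /=; exact: le_trans (hK x) (ltW KM)].
  move=> /(_ bdd); rewrite (EFin_Rint nu bphi) => cv.
  have sub : (fun k => (k.+1 * N)%N) @ \oo --> \oo.
    apply/cvgnyPge => M; near=> k; apply: (@leq_trans k).
      by near: k; exact: nbhs_infty_ge.
    by rewrite (leq_trans (leqnSn k))// leq_pmulr.
  have := cvg_comp _ _ sub cv => /fine_cvg; apply: cvg_trans; apply: near_eq_cvg.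
  apply: nearW => k /=; rewrite integral_zero_counting//; last by move=> x; exact: log_ratio_ge0.
  by rewrite /h potential_diff_roots.
have main k : \int[P]_w (potential_diff (a w) (b w) E eps del N) <=
   N%:R * \int[P]_w h k w + cut_cost eps del.
  have := mean_potential_diff_superadd k d0 de N0 A0.
  have kR : 0 < k.+1%:R :> R by rewrite ltr0n.
  rewrite /h RintZ; last exact: bmeas_potential_diff.
  set G := \int[P]_w _; set G' := \int[P]_w _ => hG.
  rewrite -(ler_pM2l kR) natrM mulrDr.
  have -> : k.+1%:R * (N%:R * ((k.+1%:R * N%:R)^-1 * G')) = G'.
    by field; rewrite !gt_eqF.
  by apply: (le_trans hG); rewrite lerD2l ler_wpM2r// ler_nat.
have cv : N%:R * \int[P]_w h k w + cut_cost eps del @[k --> \oo] -->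
    N%:R * \int[nu]_x (log_ratio E eps del x) + cut_cost eps del.
  by apply: cvgD; [apply: cvgM => //; exact: cvg_cst|exact: cvg_cst].
exact: (ler_cvg_to (cvg_cst _) cv (nearW _ main)).
Unshelve. all: by end_near. Qed.

End mean.

(** * Growth at a zero of the Lyapunov exponent *)

Import Normc.

Lemma operator_norm_ub (R : realType) (M : 'M[R]_2) (v : 'cV[R]_2) :
  euclidean_norm v <= 1 -> euclidean_norm (M *m v) <= operator_norm M.
Proof.
move=> v1; apply: sup_upper_bound; last by exists v.
split; first by exists (euclidean_norm (M *m v)); exists v.
exists (Num.sqrt (\sum_i (\sum_j `|M i j|) ^+ 2)) => _ [u /= u1 <-].
rewrite ler_wsqrtr//; apply: ler_sum => i _.
rewrite -real_normK ?num_real// ler_pXn2r ?nnegrE ?sumr_ge0// mxE.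
apply: (le_trans (ler_norm_sum _ _ _)); apply: ler_sum => j _.
rewrite normrM ler_piMr//; apply: le_trans u1.
rewrite -sqrtr_sqr ler_wsqrtr// (bigD1 j)//= lerDl.
by apply: sumr_ge0 => k _; exact: sqr_ge0.
Qed.

Lemma entry_le_norm (R : realType) (v : 'cV[R]_2) i : `|v i 0| <= euclidean_norm v.
Proof.
rewrite -sqrtr_sqr ler_wsqrtr// (bigD1 i)//= lerDl.
by apply: sumr_ge0 => k _; exact: sqr_ge0.
Qed.

(** The transfer matrix acts on (u_1, u_0), which corresponds to (x, c) because
    its a_0 is one. *)
Lemma jacobi_sol_le_operator_norm (R : realType) (a b : nat -> R) (E x c : R) n :
  (forall k, a k != 0) -> x ^+ 2 + c ^+ 2 <= 1 ->
  `|(jacobi_sol a b E x c n).1| <= operator_norm (transfer (set_a0 a) b E n).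
Proof.
move=> a0 xc; pose u k := if k is j.+1 then (jacobi_sol a b E x c j).1 else c.
have sa k : (0 < k)%N -> set_a0 a k != 0 by case: k => // k _; exact: a0.
have su k : (0 < k)%N ->
    set_a0 a k * u k.+1 + (b k - E) * u k + set_a0 a k.-1 * u k.-1 = 0.
  case: k => // -[|k] _; rewrite /u /=; first by have h := a0 1%N; field.
  by have h := a0 k.+2; have h' := a0 k.+1; field; rewrite h h'.
have h := transferP sa su n.
have : `|col2 (u n.+1) (u n) 0 0| <= operator_norm (transfer (set_a0 a) b E n).
  rewrite h; apply: (le_trans (entry_le_norm _ _)); apply: operator_norm_ub.
  rewrite /euclidean_norm !big_ord_recl big_ord0 !mxE /= addr0.
  by rewrite -[leRHS]sqrtr1 ler_wsqrtr.
by rewrite mxE.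
Qed.

(** The constant C absorbs the finitely many n for which the exponential bound of
    the norm does not hold yet. *)
Lemma lyapunov_growth (R : realType) (a b : nat -> R) (E kap : R) :
  (forall k, a k != 0) -> 0 < kap ->
  n%:R^-1 * ln (operator_norm (transfer (set_a0 a) b E n)) @[n --> \oo] --> (0 : R) ->
  exists2 C : R, 1 <= C & forall n,
    `|psol a b E n| <= C * expR (kap * n%:R) /\ `|qsol a b E n| <= C * expR (kap * n%:R).
Proof.
move=> a0 k0 hc; have [N _ hN] := cvgr_lt _ hc _ k0.
have hp n : `|psol a b E n| <= operator_norm (transfer (set_a0 a) b E n).
  by apply: jacobi_sol_le_operator_norm => //; rewrite expr1n expr0n addr0.
have hq n : `|qsol a b E n| <= operator_norm (transfer (set_a0 a) b E n).
  by apply: jacobi_sol_le_operator_norm => //; rewrite sqrrN expr1n expr0n add0r.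
pose C := 1 + \sum_(i < N.+1) operator_norm (transfer (set_a0 a) b E i).
have o0 n : 0 <= operator_norm (transfer (set_a0 a) b E n) by exact: le_trans (hp n).
have C1 : 1 <= C by rewrite lerDl sumr_ge0.
exists C => // n.
suff main : operator_norm (transfer (set_a0 a) b E n) <= C * expR (kap * n%:R).
  by split; [exact: le_trans (hp n) main|exact: le_trans (hq n) main].
have e1 : 1 <= expR (kap * n%:R) by rewrite -expR0 ler_expR mulr_ge0// ltW.
have [nN|Nn] := ltnP n N.+1.
  apply: (@le_trans _ _ C); last by rewrite ler_peMr// (le_trans ler01).
  by rewrite /C (bigD1 (Ordinal nN))//= addrCA lerDl addr_ge0// sumr_ge0.
apply: (@le_trans _ _ (expR (kap * n%:R))); last by rewrite ler_peMl// (le_trans ler01).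
have n0 : (0 < n)%N by exact: leq_ltn_trans Nn.
have := hN n (ltnW Nn); rewrite /= mulrC ltr_pdivrMr ?ltr0n// => h.
have [M0|M0] := leP (operator_norm (transfer (set_a0 a) b E n)) 0.
  by rewrite (le_trans M0) ?expR_ge0.
by rewrite -[leLHS]lnK ?posrE// ler_expR ltW.
Qed.

(** The square of exp (x / 2) >= x / 2. *)
Lemma expR_quad (R : realType) (x : R) : 0 <= x -> x ^+ 2 / 4 <= expR x.
Proof.
move=> x0; have -> : expR x = expR (x / 2) ^+ 2 by rewrite -expRM_natl; congr expR; field.
have -> : x ^+ 2 / 4 = (x / 2) ^+ 2 by field.
rewrite ler_pXn2r ?nnegrE ?expR_ge0 ?divr_ge0//.
by apply: le_trans (expR_ge1Dx _); rewrite lerDr.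
Qed.

(** Variation of constants around the real energy E with the increment i del,
    del = x^-3 and x = exp (kap N): the kernel is at most 2 (C x)^2 on the
    window, so the correction is at most N del 2 (C x)^2 times the largest value
    2 C x allowed by the induction, which is at most C x for large N. *)
Lemma psol_perturb (R : realType) (a b : nat -> R) (E C kap : R) :
  (forall k, 0 < a k) -> 0 < kap -> 1 <= C ->
  (forall n, `|psol a b E n| <= C * expR (kap * n%:R) /\
             `|qsol a b E n| <= C * expR (kap * n%:R)) ->
  \forall N \near \oo,
    ln_sqmod_psol a b E (expR (- (3 * kap * N%:R))) N <= 4 * kap * N%:R.
Proof.
move=> ha k0 C1 hC; have C0 : 0 < C by exact: lt_le_trans C1.
(* Chosen so that 4 N C^2 <= (kap N)^2 / 4 <= exp (kap N). *)
exists (Num.Def.archi_bound (16 * C ^+ 2 / kap ^+ 2)).+1 => // N /= Nbig.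
have N1 : 1 <= N%:R :> R by rewrite ler1n (leq_trans _ Nbig).
have NB : 16 * C ^+ 2 <= kap ^+ 2 * N%:R.
  rewrite [leRHS]mulrC -ler_pdivrMr ?exprn_gt0//; apply/ltW.
  apply: lt_le_trans (archi_boundP _) _.
    by rewrite divr_ge0 ?mulr_ge0 ?exprn_ge0// ltW.
  by rewrite ler_nat ltnW.
set x := expR (kap * N%:R); have x0 : 0 < x by exact: expR_gt0.
have xbig : 4 * N%:R * C ^+ 2 <= x.
  apply: le_trans (expR_quad _); last by rewrite mulr_ge0// ltW.
  by rewrite exprMn; nra.
set del := expR _; have delE : del = x ^- 3.
  by rewrite /del /x -expRM_natl -expRN; congr expR; ring.
have d0 : 0 < del by exact: expR_gt0.
set z := Complex E del.
have an k : a k != 0 by rewrite gt_eqF.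
have can k : cseq a k != 0 by rewrite /cseq fmorph_eq0.
have pE j : psol (cseq a) (cseq b) (real_complex R E) j = real_complex R (psol a b E j).
  by have := jacobi_sol_rmorph (real_complex R) a b E 1 0 j; rewrite rmorph1 rmorph0 /psol => ->.
have qE j : qsol (cseq a) (cseq b) (real_complex R E) j = real_complex R (qsol a b E j).
  by have := jacobi_sol_rmorph (real_complex R) a b E 0 (-1) j;
    rewrite rmorphN rmorph1 rmorph0 /qsol => ->.
have kE i j : wkernel (cseq a) (cseq b) (real_complex R E) i j = real_complex R (wkernel a b E i j).
  by rewrite /wkernel !pE !qE rmorphB !rmorphM.
have hx j : (j <= N)%N -> `|psol a b E j| <= C * x /\ `|qsol a b E j| <= C * x.
  move=> jN; have [h1 h2] := hC j.
  have hh : C * expR (kap * j%:R) <= C * x.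
    by rewrite ler_wpM2l ?(ltW C0)// ler_expR ler_wpM2l ?(ltW k0)// ler_nat.
  by split; [exact: le_trans h1 hh|exact: le_trans h2 hh].
have kb i j : (i <= N)%N -> (j <= N)%N -> `|wkernel a b E i j| <= 2 * (C * x) ^+ 2.
  move=> iN jN; have [p1 q1] := hx i iN; have [p2 q2] := hx j jN.
  apply: (le_trans (ler_normB _ _)); rewrite !normrM mulr2n mulrDl mul1r expr2.
  by apply: lerD; apply: ler_pM.
pose M := 2 * (C * x).
have M0 : 0 < M by rewrite !mulr_gt0.
have dec : del * (N%:R * (2 * (C * x) ^+ 2 * M)) <= C * x.
  rewrite delE /M; have -> : x ^- 3 * (N%:R * (2 * (C * x) ^+ 2 * (2 * (C * x)))) =
    (4 * N%:R * C ^+ 2) * C by field; rewrite gt_eqF.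
  by rewrite [leRHS]mulrC ler_wpM2r// ltW.
have main j : (j <= N)%N -> normc (psol (cseq a) (cseq b) z j) <= M.
  elim/ltn_ind: j => j IH jN.
  rewrite (variation_of_constants (cseq b) (real_complex R E) z j can) pE.
  apply: (le_trans (le_normcD _ _)); rewrite normcM.
  have -> : normc (real_complex R (psol a b E j)) = `|psol a b E j|.
    by rewrite /= expr0n addr0 sqrtr_sqr.
  have -> : normc (z - real_complex R E) = del.
    by rewrite /= subrr expr0n add0r subr0 sqrtr_sqr gtr0_norm.
  have S : normc (\sum_(i < j) wkernel (cseq a) (cseq b) (real_complex R E) i j *
      psol (cseq a) (cseq b) z i) <= j%:R * (2 * (C * x) ^+ 2 * M).
    have : forall l, (l <= j)%N -> normc (\sum_(i < l) wkernel (cseq a) (cseq b) (real_complex R E) i j *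
      psol (cseq a) (cseq b) z i) <= l%:R * (2 * (C * x) ^+ 2 * M).
      elim=> [_|l IHl lj]; first by rewrite big_ord0 normc0 mul0r.
      rewrite big_ord_recr /= (le_trans (le_normcD _ _))// -[l.+1%:R]natr1 [(_ + 1) * _]mulrDl mul1r.
      apply: lerD; first exact: IHl (ltnW lj).
      have lN : (l <= N)%N by rewrite (leq_trans (ltnW lj)).
      rewrite normcM; apply: ler_pM.
      - by case: (wkernel _ _ _ _ _) => ? ? /=; rewrite sqrtr_ge0.
      - by case: (psol _ _ _ _) => ? ? /=; rewrite sqrtr_ge0.
      - by rewrite kE /= expr0n addr0 sqrtr_sqr kb.
      - exact: IH.
    by apply.
  have [p1 _] := hx j jN.
  have := ler_wpM2l (ltW d0) S.
  have : del * (j%:R * (2 * (C * x) ^+ 2 * M)) <= C * x.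
    apply: le_trans dec; rewrite ler_wpM2l ?(ltW d0)// ler_wpM2r ?ler_nat//.
    by rewrite !mulr_ge0 ?exprn_ge0 ?mulr_ge0 ?(ltW M0) ?(ltW C0) ?(ltW x0).
  rewrite /M; lra.
have nb : sqmod (psol (cseq a) (cseq b) z N) <= M ^+ 2.
  have := main N (leqnn _); case: (psol _ _ _ _) => u v /= h.
  rewrite /sqmod /= -[leLHS]sqr_sqrtr ?addr_ge0 ?sqr_ge0//.
  by rewrite ler_pXn2r ?nnegrE ?sqrtr_ge0 ?(ltW M0).
have Mx : M ^+ 2 <= x ^+ 4.
  have -> : x ^+ 4 = (x ^+ 2) ^+ 2 by rewrite -exprM.
  rewrite ler_pXn2r ?nnegrE ?(ltW M0) ?exprn_ge0 ?(ltW x0)// /M expr2 mulrA.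
  rewrite ler_wpM2r ?(ltW x0)//; apply: le_trans xbig.
  have : C <= N%:R * C ^+ 2 by nra.
  by have := C0; nra.
rewrite /ln_sqmod_psol -/z; have p0 : 0 < sqmod (psol (cseq a) (cseq b) z N).
  by rewrite sqmod_gt0 psol_neq0.
rewrite -ler_expR lnK ?posrE//; apply: (le_trans nb); apply: (le_trans Mx).
by rewrite /x -expRM_natl le_eqVlt; apply/orP; left; apply/eqP; congr expR; ring.
Qed.

(** * The mean of the Gram determinant *)

Section mean_sqrt_gram.
Context (d : measure_display) (Omega : measurableType d) (R : realType)
  (P : probability Omega R) (T : Omega -> Omega) (f g : Omega -> R)
  (E A : R).
Hypotheses (pT : measure_preserving P T)
  (mf : measurable_fun [set: Omega] f) (mg : measurable_fun [set: Omega] g)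
  (A0 : 0 < A)
  (hA : forall w k, 0 < orbit_seq T f w k <= A /\ `|orbit_seq T g w k| <= A)
  (hlyap : is_lyapunov_exponent P T f g E 0).

Let a w := orbit_seq T f w.
Let b w := orbit_seq T g w.
Let a0 w k : 0 < a w k. Proof. by have [/andP[]] := hA w k. Qed.
Let f0 w : 0 < f w. Proof. exact: (a0 w 0%N). Qed.
Let mT : measurable_fun [set: Omega] T. Proof. by case: pT. Qed.

Lemma bmeas_min_sqrt_gram n W : 0 <= W -> bounded_meas (fun w => Num.min (sqrt_gram (a w) (b w) E n) W).
Proof.
move=> W0; split.
  by apply: measurable_minr; [exact: measurable_sqrt_gram|exact: measurable_cst].
exists W => w; rewrite ger0_norm; first by rewrite ge_min lexx orbT.
by rewrite le_min W0 sqrt_gram_ge0.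
Qed.

Definition small_shift (kap : R) (N : nat) : R := expR (- (3 * kap * N%:R)).

(** The orbits along which the solution at E + i small_shift is exceptionally
    large; their probability tends to zero when the Lyapunov exponent is zero. *)
Definition large_psol (kap : R) (N : nat) : set Omega :=
  [set w | 4 * kap * N%:R < ln_sqmod_psol (a w) (b w) E (small_shift kap N) N].

Lemma measurable_large_psol kap N : measurable (large_psol kap N).
Proof.
rewrite (_ : large_psol kap N =
    (fun w => ln_sqmod_psol (a w) (b w) E (small_shift kap N) N) @^-1` `]4 * kap * N%:R, +oo[).
  by rewrite -[X in measurable X]setTI; apply: measurable_ln_sqmod_psol => //; exact: measurable_itv.
by apply/seteqP; split => w; rewrite /large_psol /= in_itv /= andbT.
Qed.

Lemma mean_large_psol_cvg kap n : 0 < kap -> (0 < n)%N ->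
  \int[P]_w (\1_(large_psol kap (k.+1 * n).+1) w : R) @[k --> \oo] --> (0 : R).
Proof.
move=> k0 n0; apply: (@Rint_cvg_cst _ _ _ _ _ 1).
- by move=> k; apply: measurable_indic; exact: measurable_large_psol.
- by move=> k w; rewrite indicE; case: (_ \in _); rewrite ?normr1// normr0.
apply: filterS hlyap => w hw.
have an k : orbit_seq T f w k != 0 by rewrite gt_eqF//; exact: (a0 w k).
have [C C1 hC] := lyapunov_growth an k0 hw.
have [M _ hM] := psol_perturb (a0 w) k0 C1 hC.
apply: (@cvg_trans _ (cst 0 @ \oo)); last exact: cvg_cst.
apply: near_eq_cvg; near=> k.
rewrite /cst indicE memNset//= /large_psol /=; apply/negP; rewrite -leNgt.
apply: hM => /=; apply: (@leq_trans k); first by near: k; exact: nbhs_infty_ge.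
by apply: leqW; rewrite (leq_trans (leqnSn k))// leq_pmulr.
Unshelve. all: by end_near. Qed.

(** On the exceptional set each truncated term is bounded by W. Elsewhere
    ln |p_N (E + i eps)|^2 is split into its value at E + i small_shift, which
    is at most 4 kap N, and the difference of potentials. *)
Lemma sum_min_sqrt_gram_le n k eps kap W w : 0 < eps -> 0 < kap -> 0 <= W ->
  let N := (k * n).+1 in small_shift kap N <= eps ->
  \sum_(i < k) Num.min (sqrt_gram (a (iter (i * n) T w)) (b (iter (i * n) T w)) E n) W <=
  k%:R * W * \1_(large_psol kap N) w +
  (eps^-1 + W) * (4 * kap * N%:R + potential_diff (a w) (b w) E eps (small_shift kap N) N
                  + `|2 * ln (A / eps)|).
Proof.
move=> e0 k0 W0 N de; have d0 : 0 < small_shift kap N by exact: expR_gt0.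
have /andP[F0 _] := potential_diff_bounds (b w) E N (a0 w) d0 de.
have eW : 0 <= eps^-1 + W by rewrite addr_ge0// invr_ge0 ltW.
rewrite indicE; have [wbad|wbad] := boolP (w \in large_psol kap N).
  rewrite mulr1 -[leLHS]addr0; apply: lerD.
    rewrite mulr_natl -[k in leRHS]card_ord -sumr_const; apply: ler_sum => i _.
    by rewrite ge_min lexx orbT.
  have h4 : 0 <= 4 * kap * N%:R by rewrite !mulr_ge0// ltW.
  by apply: mulr_ge0 => //; apply: addr_ge0 => //; exact: addr_ge0.
rewrite mulr0 add0r.
have := sum_blocks_le n k (b w) E e0 (fun k => (hA w k).1) W0.
under eq_bigr do rewrite !orbit_shift.
move=> /le_trans; apply; apply: ler_wpM2l => //.
move: wbad; rewrite notin_setE /large_psol /= => /negP; rewrite -leNgt => hb.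
have := ler_norm (2 * ln (A / eps)).
rewrite -/(ln_sqmod_psol (a w) (b w) E eps N) /potential_diff; lra.
Qed.

Lemma mean_min_sqrt_gram_le n k eps kap W (nu : probability (measurableTypeR R) R) (K : R) :
  0 < eps -> 0 < kap -> 0 <= W ->
  is_density_of_states P T f g nu ->
  (forall e dl, 0 < dl -> dl <= e -> \int[nu]_x (log_ratio E e dl x) <= K * e) ->
  let N := (k * n).+1 in small_shift kap N <= eps ->
  k%:R * \int[P]_w Num.min (sqrt_gram (a w) (b w) E n) W <=
  k%:R * W * \int[P]_w (\1_(large_psol kap N) w) +
  (eps^-1 + W) * (4 * kap * N%:R + (N%:R * (K * eps) + cut_cost E A eps (small_shift kap N))
                  + `|2 * ln (A / eps)|).
Proof.
move=> e0 k0 W0 hnu hK N de; have d0 : 0 < small_shift kap N by exact: expR_gt0.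
have eW : 0 <= eps^-1 + W by rewrite addr_ge0// invr_ge0 ltW.
pose q w := Num.min (sqrt_gram (a w) (b w) E n) W.
have bq : bounded_meas q by exact: bmeas_min_sqrt_gram.
have bqT i : bounded_meas (fun w => q (iter (i * n) T w)).
  by have [mTn _] := measure_preserving_iter (i * n) pT; exact: bmeas_comp.
have bF : bounded_meas (fun w => potential_diff (a w) (b w) E eps (small_shift kap N) N).
  exact: (bmeas_potential_diff E pT mf mg hA).
have bbad : bounded_meas (fun w => \1_(large_psol kap N) w : R).
  by apply: bmeas_indic; exact: measurable_large_psol.
have -> : k%:R * \int[P]_w q w = \int[P]_w (\sum_(i < k) q (iter (i * n) T w)).
  rewrite (Rint_sum P k bqT) mulr_natl -[k in LHS]card_ord -sumr_const.
  apply: eq_bigr => i _; rewrite -(Rint_invariant (measure_preserving_iter (i * n) pT))//.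
have bR : bounded_meas (fun w => 4 * kap * N%:R + potential_diff (a w) (b w) E eps (small_shift kap N) N
                  + `|2 * ln (A / eps)|).
  by apply: bmeasD; [apply: bmeasD => //|]; exact: bmeas_cst.
apply: (@le_trans _ _ (\int[P]_w (k%:R * W * \1_(large_psol kap N) w +
  (eps^-1 + W) * (4 * kap * N%:R + potential_diff (a w) (b w) E eps (small_shift kap N) N
                  + `|2 * ln (A / eps)|)))).
  apply: le_Rint; first exact: (bmeas_sum k bqT).
    by apply: bmeasD; exact: bmeasZ.
  by move=> w; exact: sum_min_sqrt_gram_le.
rewrite RintD; [|exact: bmeasZ|exact: bmeasZ].
rewrite (RintZ P _ bbad) (RintZ P _ bR) lerD2l ler_wpM2l//.
rewrite RintD; [|by apply: bmeasD => //; exact: bmeas_cst|exact: bmeas_cst].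
rewrite RintD; [|exact: bmeas_cst|by []].
rewrite !Rint_cst lerD2r lerD2l.
apply: (le_trans (mean_potential_diff_le E pT mf mg hA hnu d0 de (ltn0Sn _) A0)).
by rewrite lerD2r ler_wpM2l// hK.
Qed.

(** The cost at small_shift = exp (- 3 kap N) is linear in kap N. *)
Lemma cut_cost_le eps kap N : 0 < kap ->
  cut_cost E A eps (small_shift kap N) <= cut_cost E A eps 1 + 12 * kap * N%:R.
Proof.
move=> k0; rewrite /cut_cost -[leRHS]addrA lerD2l /small_shift.
set dd := expR _; have d0 : 0 < dd by exact: expR_gt0.
have d1 : dd <= 1.
  by rewrite -expR0 ler_expR oppr_le0 !mulr_ge0// ltW.
have -> : 12 * kap * N%:R = - ln (dd ^+ 4) by rewrite lnXn// expRK; ring.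
have dd40 : 0 < dd ^+ 4 by rewrite exprn_gt0.
have A4 : 0 < A ^+ 4 by rewrite exprn_gt0.
rewrite -ln_div ?posrE//; last by rewrite expr1n divr1 addr_gt0// mulr_gt0.
rewrite ler_ln ?posrE; last 2 first.
- by rewrite addr_gt0// divr_gt0// mulr_gt0.
- by rewrite expr1n divr1 divr_gt0// addr_gt0// mulr_gt0.
rewrite expr1n divr1 [(2 + _) / _]mulrDl lerD2r ler_pdivlMr// ler_piMr//.
by rewrite exprn_ile1// ltW.
Qed.

(** Let first the number of blocks tend to infinity, then kap to zero: the mean
    is at most (1 / eps + W) n K eps = (1 + W eps) n K. Then eps tends to zero;
    W is fixed throughout. *)
Lemma mean_min_sqrt_gram_bound n W (nu : probability (measurableTypeR R) R) (K : R) :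
  (0 < n)%N -> 0 <= W ->
  is_density_of_states P T f g nu ->
  (forall e dl, 0 < dl -> dl <= e -> \int[nu]_x (log_ratio E e dl x) <= K * e) ->
  \int[P]_w Num.min (sqrt_gram (a w) (b w) E n) W <= K * n%:R.
Proof.
move=> n0 W0 hnu hK; set m := \int[P]_w _.
have step eps kap : 0 < eps -> 0 < kap ->
    m <= (eps^-1 + W) * (n%:R * (16 * kap + K * eps)).
  move=> e0 k0; have eW : 0 <= eps^-1 + W by rewrite addr_ge0// invr_ge0 ltW.
  pose c := cut_cost E A eps 1 + `|2 * ln (A / eps)| + (16 * kap + K * eps).
  pose r k := \int[P]_w (\1_(large_psol kap (k.+1 * n).+1) w : R).
  have ev : \forall k \near \oo, m <= W * r k + (eps^-1 + W) *
      (n%:R * (16 * kap + K * eps) + k.+1%:R^-1 * c).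
    near=> k; have kR : 0 < k.+1%:R :> R by rewrite ltr0n.
    have de : small_shift kap (k.+1 * n).+1 <= eps.
      rewrite -[leRHS]lnK ?posrE// /small_shift ler_expR lerNl.
      have hk : - ln eps / (3 * kap) <= k%:R.
        by near: k; exact: nbhs_infty_ger.
      move: hk; rewrite ler_pdivrMr ?mulr_gt0// mulrC => /le_trans; apply.
      rewrite ler_wpM2l ?mulr_ge0 ?(ltW k0)// ler_nat.
      by apply: leqW; rewrite (leq_trans (leqnSn k))// leq_pmulr.
    have := mean_min_sqrt_gram_le e0 k0 W0 hnu hK de; rewrite -/m -/(r k) => hm.
    rewrite -(ler_pM2l kR); apply: (le_trans hm).
    rewrite [leRHS]mulrDr -[_ * W * _]mulrA lerD2l [leRHS]mulrCA ler_wpM2l//.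
    rewrite [leRHS]mulrDr [_ * (_^-1 * c)]mulrA mulfV ?gt_eqF// mul1r /c.
    have := cut_cost_le eps (k.+1 * n).+1 k0.
    by rewrite -[(k.+1 * n).+1%:R]natr1 natrM; lra.
  have cv : W * r k + (eps^-1 + W) * (n%:R * (16 * kap + K * eps) + k.+1%:R^-1 * c)
     @[k --> \oo] --> W * 0 + (eps^-1 + W) * (n%:R * (16 * kap + K * eps) + 0 * c).
    apply: cvgD; first by apply: cvgM; [exact: cvg_cst|exact: mean_large_psol_cvg].
    apply: cvgM; first exact: cvg_cst.
    apply: cvgD; first exact: cvg_cst.
    by apply: cvgM; [exact: cvg_harmonic|exact: cvg_cst].
  have := ler_cvg_to (cvg_cst m) cv ev.
  by rewrite mulr0 mul0r add0r addr0; exact.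
have step2 eps : 0 < eps -> m <= (1 + W * eps) * (n%:R * K).
  move=> e0; have eW : 0 < eps^-1 + W by rewrite ltr_pwDl// invr_gt0.
  have nR : 0 < n%:R :> R by rewrite ltr0n.
  (* With this kap the term in 16 kap is exactly e. *)
  apply/ler_addgt0Pr => e ee; pose kap := e / ((eps^-1 + W) * (n%:R * 16)).
  have k0 : 0 < kap by rewrite divr_gt0// !mulr_gt0.
  apply: (le_trans (step eps kap e0 k0)); rewrite le_eqVlt; apply/orP; left; apply/eqP.
  rewrite /kap; have := e0; have eW' : 1 + W * eps != 0.
    by rewrite gt_eqF// ltr_pwDl// mulr_ge0// ltW.
  by move=> _; field; rewrite !gt_eqF//= ltr_pwDl// mulr_ge0// ltW.
rewrite mulrC; apply/ler_addgt0Pr => e ee.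
(* The 1 avoids a division by zero when W or K vanishes. *)
pose eps := e / (1 + W * `|n%:R * K|).
have q0 : 0 < 1 + W * `|n%:R * K| by rewrite ltr_pwDl// mulr_ge0.
have e0 : 0 < eps by rewrite divr_gt0.
apply: (le_trans (step2 eps e0)); rewrite mulrDl mul1r lerD2l.
apply: (@le_trans _ _ (eps * (W * `|n%:R * K|))).
  by rewrite mulrAC mulrC ler_wpM2l ?(ltW e0)// ler_wpM2l// ler_norm.
by rewrite /eps mulrAC ler_pdivrMr// ler_wpM2l ?(ltW ee)// lerDr.
Unshelve. all: by end_near. Qed.

End mean_sqrt_gram.

(** * Superadditive processes over an ergodic map *)

Section superadditive.
Context (d : measure_display) (Omega : measurableType d) (R : realType)
  (P : probability Omega R) (T : Omega -> Omega) (Q : nat -> Omega -> R) (K : R).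
Hypotheses (eT : ergodic P T)
  (mQ : forall n, measurable_fun [set: Omega] (Q n))
  (Q0 : forall n w, 0 <= Q n w)
  (QD : forall n m w, Q n w + Q m (iter n T w) <= Q (n + m)%N w)
  (QK : forall n W, (0 < n)%N -> 0 <= W -> \int[P]_w Num.min (Q n w) W <= K * n%:R).

Let pT : measure_preserving P T. Proof. by case: eT. Qed.
Let mT : measurable_fun [set: Omega] T. Proof. by case: pT. Qed.
Let mTn n : measurable_fun [set: Omega] (iter n T).
Proof. by case: (measure_preserving_iter n pT). Qed.

Definition reached (c : R) (L : nat) : set Omega :=
  \bigcup_(n in [set n | (0 < n <= L)%N]) [set w | c * n%:R <= Q n w].

Lemma measurable_ge c n : measurable [set w | c * n%:R <= Q n w].
Proof.
rewrite (_ : [set w | _] = Q n @^-1` `[c * n%:R, +oo[).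
  by rewrite -[X in measurable X]setTI; apply: mQ => //; exact: measurable_itv.
by apply/seteqP; split => w; rewrite /= in_itv /= andbT.
Qed.

Lemma measurable_reached c L : measurable (reached c L).
Proof. by apply: bigcup_measurable => n _; exact: measurable_ge. Qed.

(** Walk along the orbit: at a point of the reached set jump over a block where
    Q is at least c times the length, elsewhere move by one site. By
    superadditivity and positivity, Q_N is at least c times the number of
    visits to the reached set, up to the last block. *)
Lemma tiling c L N w : 0 <= c ->
  c * \sum_(j < N) \1_(reached c L) (iter j T w) - c * L%:R <= Q N w.
Proof.
move=> c0; elim/ltn_ind: N w => N IH w.
have ind v : \1_(reached c L) v <= 1 :> R by rewrite indicE; case: (_ \in _).
have sum_le M v : \sum_(j < M) \1_(reached c L) (iter j T v) <= M%:R :> R.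
  by rewrite -[M in leRHS]card_ord -sumr_const; apply: ler_sum => j _.
have [NL|LN] := leqP N L.
  apply: le_trans (Q0 N w); rewrite subr_le0 ler_wpM2l//.
  by apply: (le_trans (sum_le N w)); rewrite ler_nat.
have skip n : (0 < n <= N)%N ->
    c * \sum_(j < n) \1_(reached c L) (iter j T w) <= Q n w ->
    c * \sum_(j < N) \1_(reached c L) (iter j T w) - c * L%:R <= Q N w.
  move=> /andP[n0 nN] hn; have := QD n (N - n) w; rewrite subnKC// => /(le_trans _); apply.
  have NnN : (N - n < N)%N by rewrite ltn_subrL n0 (leq_trans n0).
  have := IH _ NnN (iter n T w).
  have -> : \sum_(j < N) \1_(reached c L) (iter j T w) =
     \sum_(j < n) \1_(reached c L) (iter j T w) +
     \sum_(j < N - n) \1_(reached c L) (iter j T (iter n T w)) :> R.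
    rewrite -[in LHS](subnKC nN) big_split_ord /=; congr (_ + _).
    by apply: eq_bigr => j _; rewrite addnC iterD.
  by rewrite mulrDr; lra.
have [wG|wG] := boolP (w \in reached c L).
  move: wG; rewrite inE => -[n /= /andP[n0 nL] hn].
  apply: (skip n); first by rewrite n0 (leq_trans nL)// ltnW.
  by apply: le_trans hn; rewrite ler_wpM2l.
apply: (skip 1%N); first by rewrite (leq_ltn_trans _ LN).
by rewrite big_ord_recl big_ord0 /= indicE (negbTE wG) addr0 mulr0.
Qed.

(** Integrate the tiling inequality, truncating Q_N at c N, which is what its
    left-hand side never exceeds, and divide by N. *)
Lemma prob_reached_le c L : 0 <= c -> c * fine (P (reached c L)) <= K.
Proof.
move=> c0; set p := fine _.
have bG : bounded_meas (fun w => \1_(reached c L) w : R).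
  by apply: bmeas_indic; exact: measurable_reached.
have bGT j : bounded_meas (fun w => \1_(reached c L) (iter j T w) : R) by exact: bmeas_comp.
have step N : (0 < N)%N -> c * p * N%:R - c * L%:R <= K * N%:R.
  move=> N0; have NR : 0 <= c * N%:R by rewrite mulr_ge0.
  apply: le_trans (QK N0 NR).
  have -> : c * p * N%:R - c * L%:R =
      \int[P]_w (c * (\sum_(j < N) \1_(reached c L) (iter j T w)) + - (c * L%:R)).
    have bS := bmeas_sum N bGT.
    rewrite RintD; [|exact: (bmeasZ c bS)|exact: bmeas_cst].
    rewrite Rint_cst (RintZ P c bS) (Rint_sum P N bGT) -mulrA; congr (c * _ + _).
    transitivity (\sum_(j < N) p); first by rewrite sumr_const card_ord mulr_natr.
    apply: eq_bigr => j _.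
    rewrite -[p](Rint_indic P (measurable_reached c L)).
    by rewrite -(Rint_invariant (measure_preserving_iter j pT) bG).
  apply: le_Rint.
  - by apply: bmeasD; [apply: bmeasZ; exact: (bmeas_sum N bGT)|exact: bmeas_cst].
  - split; first by apply: measurable_minr => //; exact: measurable_cst.
    exists (c * N%:R) => w; rewrite ger0_norm; first by rewrite ge_min lexx orbT.
    by rewrite le_min Q0.
  - move=> w; rewrite le_min tiling//=.
    have : \sum_(j < N) \1_(reached c L) (iter j T w) <= N%:R :> R.
      rewrite -[N in leRHS]card_ord -sumr_const; apply: ler_sum => j _.
      by rewrite indicE; case: (_ \in _).
    move=> /(ler_wpM2l c0); have : 0 <= c * L%:R by rewrite mulr_ge0.
    lra.
have cv : c * p - n.+1%:R^-1 * (c * L%:R) @[n --> \oo] --> c * p - 0 * (c * L%:R).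
  apply: cvgB; first exact: cvg_cst.
  by apply: cvgM; [exact: cvg_harmonic|exact: cvg_cst].
have := ler_cvg_to cv (cvg_cst K) (nearW _ _).
rewrite mul0r subr0; apply => n; have nR : 0 < n.+1%:R :> R by rewrite ltr0n.
rewrite -(ler_pM2r nR) mulrBl.
have -> : n.+1%:R^-1 * (c * L%:R) * n.+1%:R = c * L%:R by field; rewrite gt_eqF.
exact: step.
Qed.

Definition often_reached (c : R) : set Omega :=
  \bigcap_m \bigcup_(n in [set n | (m < n)%N]) [set w | c * n%:R <= Q n w].

(** The union over the
    levels above c leaves the room needed to compare a point with its image. *)
Definition often_exceeded (c : R) : set Omega := \bigcup_k often_reached (c + k.+1%:R^-1).

Lemma measurable_often_exceeded c : measurable (often_exceeded c).
Proof.
apply: bigcupT_measurable => k; apply: bigcapT_measurable => m.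
by apply: bigcup_measurable => n _; exact: measurable_ge.
Qed.

(** Q_{n+1}(w) >= Q_n(T w), and passing from n to n + 1 is absorbed by lowering
    the level from c + 1 / (k + 1) to c + 1 / (k + 2). *)
Lemma often_exceeded_preimage c : T @^-1` often_exceeded c `<=` often_exceeded c.
Proof.
move=> w [k _ hk]; exists k.+1 => // m _.
set q := c + k.+1%:R^-1 in hk; set q' := c + _.
have qq : 0 < q - q'.
  by rewrite /q /q' opprD addrACA subrr add0r subr_gt0 ltf_pV2 ?posrE ?ltr0n// ltr_nat.
have [n /= hn Qn] := hk (maxn m (Num.Def.archi_bound (`|q'| / (q - q')))) Logic.I.
exists n.+1 => /=; first by rewrite ltnS (leq_trans (leq_maxl _ _) (ltnW hn)).
apply: (@le_trans _ _ (Q n (T w))); last first.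
  by have := QD 1 n w; rewrite add1n; apply: le_trans; rewrite lerDr.
apply: le_trans Qn; rewrite -natr1 mulrDr mulr1.
have : `|q'| <= (q - q') * n%:R.
  rewrite mulrC -ler_pdivrMr//; apply/ltW; apply: lt_le_trans (archi_boundP _) _.
    by rewrite divr_ge0// ltW.
  by rewrite ler_nat (leq_trans (leq_maxr m _))// ltnW.
have := ler_norm q'; lra.
Qed.

(** The intersection of the iterated preimages is strictly invariant and has the
    same probability, so this probability is zero or one. If it is one, the
    sets reached within L have probabilities tending to one, whence c <= K. *)
Lemma often_exceeded_null c : 0 <= c -> K < c -> P (often_exceeded c) = 0%E.
Proof.
move=> c0 Kc; pose B := often_exceeded c; have mB : measurable B by exact: measurable_often_exceeded.
pose F n := iter n T @^-1` B.
have mF n : measurable (F n) by rewrite -[F n]setTI; exact: mTn.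
pose I := \bigcap_n F n.
have mI : measurable I by exact: bigcapT_measurable.
have FS n : F n.+1 `<=` F n by move=> w; rewrite /F /= => h; exact: often_exceeded_preimage.
have TI : T @^-1` I = I.
  apply/seteqP; split => w h n _; last by have := h n.+1 Logic.I; rewrite /F /= -iterSr.
  by apply: FS; rewrite /F /= -iterS iterSr; exact: (h n Logic.I).
have PF n : P (F n) = P B by case: (measure_preserving_iter n pT) => _; exact.
have PI : P I = P B.
  have := @nonincreasing_cvg_mu _ _ _ P F _ mF mI.
  have -> : P \o F = cst (P B) by apply: funext => n; rewrite /= PF.
  move=> /(_ _ _)h; have cv : cst (P B) @ \oo --> P I.
    apply: h; first exact: (le_lt_trans (probability_le1 P (mF 0%N)) (ltry 1)).
    apply/nonincreasing_seqP => n; apply/subsetPset; exact: FS.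
  by apply: (cvg_unique _ cv); [exact: ereal_hausdorff|exact: cvg_cst].
have [_ eI] := eT; case: (eI _ mI TI); rewrite PI// => PB1.
exfalso.
have cvG : P \o reached c @ \oo --> P (\bigcup_L reached c L).
  apply: nondecreasing_cvg_mu.
  - by move=> i; exact: measurable_reached.
  - by apply: bigcupT_measurable => i; exact: measurable_reached.
  - move=> i j ij; apply/subsetPset => w [n /= /andP[n0 ni] h].
    by exists n => //=; rewrite n0 (leq_trans ni).
have PG : P (\bigcup_L reached c L) = 1%E.
  apply/eqP; rewrite eq_le probability_le1/=; last first.
    by apply: bigcupT_measurable => i; exact: measurable_reached.
  rewrite -PB1; apply: le_measure; rewrite ?inE//.
    by apply: bigcupT_measurable => i; exact: measurable_reached.
  move=> w [k _ /(_ 0%N Logic.I)[n /= n0 h]]; exists n => //; exists n => /=.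
    by rewrite n0 leqnn.
  by apply: le_trans h; rewrite ler_wpM2r// lerDl.
rewrite PG in cvG; have := fine_cvg cvG => cv.
have cv2 : c * fine (P (reached c n)) @[n --> \oo] --> c * 1.
  by apply: cvgM; [exact: cvg_cst|exact: cv].
have : c * 1 <= K.
  by apply: (ler_cvg_to cv2 (cvg_cst K)); apply: nearW => n; exact: prob_reached_le.
by rewrite mulr1 leNgt Kc.
Qed.

(** One half of the subadditive ergodic theorem; positivity of Q makes it
    elementary. *)
Lemma superadditive_growth c : 0 <= c -> K < c ->
  {ae P, forall w, \forall n \near \oo, Q n w <= (c + 1) * n%:R}.
Proof.
move=> c0 Kc; exists (often_exceeded c); split.
- exact: measurable_often_exceeded.
- exact: often_exceeded_null.
move=> w hw; apply: contrapT => h; apply: hw.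
have {}h : ~ often_reached (c + 1) w by move=> o; apply: h; exists 0%N => //; rewrite invr1.
have /existsNP[m /not_implyP[_ hm]] := h.
exists m.+1 => // n /= mn; rewrite leNgt; apply/negP => hn.
by apply: hm; exists n => //=; exact: ltW.
Qed.

End superadditive.

(** * The spacing of the zeros *)

Lemma zero_above_cases (R : realType) (p : {poly R}) (E : R) :
  zero_above p E = +oo%E \/
  exists2 y, y \in rootsR p & E < y /\ zero_above p E = y%:E.
Proof.
rewrite /zero_above big_seq_cond.
apply: (big_ind (fun v : \bar R => v = +oo%E \/
  exists2 y, y \in rootsR p & E < y /\ v = y%:E)); first by left.
- by move=> u v hu hv; rewrite /mine; case: ifP.
- by move=> y /andP[yr Ey]; right; exists y.
Qed.

Lemma zero_below_cases (R : realType) (p : {poly R}) (E : R) :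
  zero_below p E = -oo%E \/
  exists2 x, x \in rootsR p & x <= E /\ zero_below p E = x%:E.
Proof.
rewrite /zero_below big_seq_cond.
apply: (big_ind (fun v : \bar R => v = -oo%E \/
  exists2 y, y \in rootsR p & y <= E /\ v = y%:E)); first by left.
- by move=> u v hu hv; rewrite /maxe; case: ifP.
- by move=> y /andP[yr Ey]; right; exists y.
Qed.

(** From the distance of two zeros on both sides of E; when one of the two zeros
    is missing the gap is infinite. *)
Lemma zero_gap_ge (R : realType) (a b : nat -> R) (E L : R) n :
  (forall k, 0 < a k) -> (0 < n)%N -> 0 < L -> sqrt_gram a b E n <= L * n%:R ->
  ((L^-1)%:E <= n%:R%:E * zero_gap a b E n)%E.
Proof.
move=> ha n0 L0 hL; have nR : 0 < n%:R :> R by rewrite ltr0n.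
have p0 : orthopoly a b n != 0 by rewrite -size_poly_eq0 size_orthopoly.
have rt x : x \in rootsR (orthopoly a b n) -> psol a b x n = 0.
  have /= <- := roots_on_rootsR p0 x.
  by rewrite /root horner_orthopolyR => /eqP.
rewrite /zero_gap.
have [->|[y yr [Ey ->]]] := zero_above_cases (orthopoly a b n) E.
  have [->|[x xr [xE ->]]] := zero_below_cases (orthopoly a b n) E;
  by rewrite /= gt0_muley ?leey// lte_fin.
have [->|[x xr [xE ->]]] := zero_below_cases (orthopoly a b n) E.
  by rewrite /= gt0_muley ?leey// lte_fin.
rewrite -EFinB -EFinM lee_fin.
have := zero_distance (fun k => lt0r_neq0 (ha k)) xE Ey (rt x xr) (rt y yr).
have yx : 0 <= y - x by lra.
move=> h; have h1 : 1 <= L * n%:R * (y - x) by apply: (le_trans h); rewrite ler_wpM2r.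
by rewrite -[L^-1]mul1r ler_pdivrMr// mulrC mulrA.
Qed.

Lemma limn_einf_ge (R : realType) (u : nat -> \bar R) (l : \bar R) :
  (\forall n \near \oo, (l <= u n)%E) -> (l <= limn_einf u)%E.
Proof.
move=> [N _ hN]; rewrite limn_einf_lim.
apply: lime_ge; first exact: is_cvg_einfs.
exists N => // n /= Nn; apply: le_ereal_inf_tmp => _ [k /= nk <-].
by apply: hN; rewrite /= (leq_trans Nn).
Qed.

Theorem theorem1p5 (R : realType) (d : measure_display)
  (Omega : measurableType d) (P : probability Omega R)
  (T : Omega -> Omega) (hT : ergodic P T)
  (f g : Omega -> R)
  (f_pos : forall w, 0 < f w)
  (f_bnd : bounded_fun f) (g_bnd : bounded_fun g)
  (f_meas : measurable_fun [set: Omega] f)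
  (g_meas : measurable_fun [set: Omega] g)
  (nu : probability (measurableTypeR R) R)
  (hnu : is_density_of_states P T f g nu)
  (E0 : R)
  (gamma : R) (hgamma : is_lyapunov_exponent P T f g E0 gamma)
  (gamma_eq0 : gamma = 0)
  (D : R) (hD : has_symmetric_derivative nu E0 D) (D_neq0 : D != 0) :
  exists C : R, 0 < C /\
    {ae P, forall w,
      (C%:E < limn_einf (fun n =>
        n%:R%:E * zero_gap (orbit_seq T f w) (orbit_seq T g w) E0 n))%E}.
Proof.
have [A A0 hA] := bounded_coefficients T f_pos f_bnd g_bnd.
have a0 w k : 0 < orbit_seq T f w k by have [/andP[]] := hA w k.
have [K K0 hK] := log_ratio_bound hD.
have [pT _] := hT; have [mT _] := pT.
rewrite gamma_eq0 in hgamma.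
pose Q n w := sqrt_gram (orbit_seq T f w) (orbit_seq T g w) E0 n.
have growth : {ae P, forall w, \forall n \near \oo, Q n w <= (K + 1 + 1) * n%:R}.
  apply: (@superadditive_growth _ _ _ P T Q K) => //; last 2 first.
  - by rewrite addr_ge0// ltW.
  - by rewrite ltrDl.
  - by move=> n; exact: measurable_sqrt_gram.
  - by move=> n w; exact: sqrt_gram_ge0.
  - move=> n m w; rewrite /Q -!orbit_shift; apply: sqrt_gram_superadd => k.
    by rewrite gt_eqF.
  - move=> n W n0 W0.
    exact: (mean_min_sqrt_gram_bound pT f_meas g_meas A0 hA hgamma n0 W0 hnu hK).
have L0 : 0 < K + 1 + 1 by rewrite !addr_gt0.
exists ((K + 1 + 1)^-1 / 2); split; first by rewrite divr_gt0// invr_gt0.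
apply: filterS growth => w hw.
apply: (@lt_le_trans _ _ ((K + 1 + 1)^-1)%:E).
  by rewrite lte_fin ltr_pdivrMr// ltr_pMr ?invr_gt0// ltr1n.
apply: limn_einf_ge; near=> n.
apply: zero_gap_ge => //; last by near: n.
by near: n; exact: nbhs_infty_gt.
Unshelve. all: by end_near. Qed.
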